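(* The variety of complex $3$-dimensional binary associative superalgebras of type $(2,1)$ has dimension $5$ and has exactly $13$ irreducible components, namely $\overline{\mathcal{O}(\mathbf{R}_{k})}$ for $k\in\{01,03,04,05,07,23,25,28,30,31,32,33,36\}$. In particular, exactly $13$ superalgebras are rigid in this variety.
   Context: All algebras are over $\mathbb{C}$. A superalgebra is a $\mathbb{Z}_2$-graded algebra $A=A_0\oplus A_1$ with $A_iA_j\subseteq A_{i+j \bmod 2}$; $|x|\in\{0,1\}$ is the degree of a homogeneous $x$. It has type $(n,m)$ if $\dim A_0=n$, $\dim A_1=m$. The associator is $(x,y,z)=(xy)z-x(yz)$. A binary associative superalgebra is a superalgebra satisfying $(x,y,z)=-(-1)^{|y||z|}(x,z,y)=-(-1)^{|x||y|}(y,x,z)$ for all homogeneous $x,y,z$. Geometric setting: fix a graded space $V=V_0\oplus V_1$ of type $(n,m)$ with a homogeneous basis. Superalgebra structures on $V$ are even bilinear maps $\mu:V\times V\to V$, identified with their structure constants; those satisfying a given family of graded polynomial identities form a Zariski-closed subset (an affine variety) of this affine space. The group $GL(V_0)\times GL(V_1)$ acts by $(g*\mu)(x,y)=g\mu(g^{-1}x,g^{-1}y)$; its orbits are the isomorphism classes. $\mathcal{O}(A)$ denotes the orbit of (a structure representing) $A$ and $\overline{\mathcal{O}(A)}$ its Zariski closure. A superalgebra is rigid if its orbit is open in the variety. The dimension of the variety is the maximal dimension of its irreducible components. Superalgebras of type $(2,1)$, in basis $e_1,e_2$ (even), $f_1$ (odd), listed by nonzero products (unlisted products are zero): $\mathbf{R}_{01}$: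 $e_1e_1=e_1,\ e_2e_2=e_2$; $\mathbf{R}_{03}$: $e_1e_1=e_1,\ e_2e_2=e_2,\ e_1f_1=f_1,\ f_1e_1=f_1,\ f_1f_1=e_1$; $\mathbf{R}_{04}$: $e_1e_1=e_1,\ e_2e_2=e_2,\ f_1e_1=f_1$; $\mathbf{R}_{05}$: $e_1e_1=e_1,\ e_2e_2=e_2,\ e_1f_1=f_1$; $\mathbf{R}_{07}$: $e_1e_1=e_1,\ e_2e_2=e_2,\ e_2f_1=f_1,\ f_1e_1=f_1$; $\mathbf{R}_{23}$: $e_1e_1=e_1,\ e_1e_2=e_2$; $\mathbf{R}_{25}$: $e_1e_1=e_1,\ e_2e_1=e_2$; $\mathbf{R}_{28}$: $e_1e_1=e_1,\ e_2e_1=e_2,\ e_1f_1=f_1,\ f_1f_1=e_2$; $\mathbf{R}_{30}$: $e_1e_1=e_1,\ e_1e_2=e_2,\ f_1e_1=f_1,\ f_1f_1=e_2$; $\mathbf{R}_{31}$: $e_1e_1=e_1,\ e_2e_1=e_2,\ f_1e_1=f_1$; $\mathbf{R}_{32}$: $e_1e_1=e_1,\ e_1e_2=e_2,\ e_1f_1=f_1$; $\mathbf{R}_{33}$: $e_1e_1=e_1,\ e_2e_1=e_2,\ e_1f_1=f_1,\ f_1e_1=f_1$; $\mathbf{R}_{36}$: $e_1e_1=e_1,\ e_1e_2=e_2,\ e_1f_1=f_1,\ f_1e_1=f_1$. *)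

(* Defs.v *)
From mathcomp Require Import all_boot all_algebra.
From mathcomp Require Import Rstruct.
From mathcomp.real_closed Require Import complex.
From mathcomp Require Import mpoly.
Set Implicit Arguments. Unset Strict Implicit. Unset Printing Implicit Defensive.
Import GRing.Theory.
Local Open Scope ring_scope.

Notation C := (Rdefinitions.R[i]).

Definition pset (T : Type) := T -> Prop.
Definition subs {T} (A B : pset T) := forall x, A x -> B x.
Definition same_set {T} (A B : pset T) := forall x, A x <-> B x.

(** The graded space V = V_0 (+) V_1 of type (2,1) with homogeneous basis
    b_0 = e_1, b_1 = e_2 (even), b_2 = f_1 (odd).  deg i is the parity of b_i. *)
Definition deg (i : 'I_3) : bool := (val i == 2)%N.

(** Ambient affine space of all bilinear maps V x V -> V, given by their 27
    structure constants c(i,j,k) (b_i b_j = sum_k c(i,j,k) b_k), stored at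
    coordinate i*9 + j*3 + k.  Evenness is imposed as part of the variety. *)
Definition Str := 'I_27 -> C.
Definition idx (i j k : 'I_3) : 'I_27 := inord (i * 9 + j * 3 + k)%N.
Definition sc (mu : Str) (i j k : 'I_3) : C := mu (idx i j k).

Definition vec := 'I_3 -> C.
Definition mult (mu : Str) (x y : vec) : vec :=
  fun k => \sum_(i < 3) \sum_(j < 3) x i * y j * sc mu i j k.
Definition assocr (mu : Str) (x y z : vec) : vec :=
  fun k => mult mu (mult mu x y) z k - mult mu x (mult mu y z) k.
Definition is_homog (d : bool) (x : vec) := forall i, deg i != d -> x i = 0.
Definition sgn (b : bool) : C := if b then -1 else 1.

Definition even_str (mu : Str) :=
  forall i j k, deg k != (deg i (+) deg j) -> sc mu i j k = 0.

Definition bin_assoc (mu : Str) :=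
  forall (dx dy dz : bool) (x y z : vec),
    is_homog dx x -> is_homog dy y -> is_homog dz z ->
    (forall k, assocr mu x y z k = - sgn (dy && dz) * assocr mu x z y k) /\
    (forall k, assocr mu x y z k = - sgn (dx && dy) * assocr mu y x z k).

Definition BAvar : pset Str := fun mu => even_str mu /\ bin_assoc mu.

Definition in_G (g : 'M[C]_3) :=
  g \in unitmx /\ (forall i j, deg i != deg j -> g i j = 0).
Definition mxapp (g : 'M[C]_3) (x : vec) : vec := fun i => \sum_(j < 3) g i j * x j.

Definition str_orbit (mu : Str) : pset Str := fun nu =>
  exists g, in_G g /\
    forall x y, mult nu x y = mxapp g (mult mu (mxapp (invmx g) x) (mxapp (invmx g) y)).

Definition vanishes (A : pset Str) (p : {mpoly C[27]}) := forall y, A y -> p.@[y] = 0.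
Definition zclosure (A : pset Str) : pset Str :=
  fun x => forall p : {mpoly C[27]}, vanishes A p -> p.@[x] = 0.
Definition zclosed (A : pset Str) := subs (zclosure A) A.

Definition irreducible (A : pset Str) :=
  (exists x, A x) /\
  forall Z1 Z2, zclosed Z1 -> zclosed Z2 ->
    subs A (fun x => Z1 x \/ Z2 x) -> subs A Z1 \/ subs A Z2.
Definition irr_component (X Y : pset Str) :=
  subs Y X /\ irreducible Y /\
  forall Y', subs Y Y' -> subs Y' X -> irreducible Y' -> subs Y' Y.

Definition has_chain (X : pset Str) (n : nat) :=
  exists Z : nat -> pset Str,
    (forall i, (i <= n)%N -> zclosed (Z i) /\ irreducible (Z i) /\ subs (Z i) X) /\
    (forall i, (i < n)%N -> subs (Z i) (Z i.+1) /\ ~ subs (Z i.+1) (Z i)).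
Definition krull_dim_eq (X : pset Str) (n : nat) := has_chain X n /\ ~ has_chain X n.+1.
Definition variety_dim_eq (X : pset Str) (n : nat) :=
  (exists Y, irr_component X Y /\ krull_dim_eq Y n) /\
  (forall Y, irr_component X Y -> ~ has_chain Y n.+1).

Definition rigid (X : pset Str) (mu : Str) :=
  X mu /\ exists Z, zclosed Z /\ same_set (str_orbit mu) (fun nu => X nu /\ ~ Z nu).

(** Structures given by lists of nonzero products b_i b_j = b_k (coefficient 1),
    with indices 0 = e1, 1 = e2, 2 = f1. *)
Definition mkstr (l : seq (nat * nat * nat)) : Str :=
  fun t => if (val t \in [seq (p.1.1 * 9 + p.1.2 * 3 + p.2)%N | p <- l]) then 1 else 0.

Definition R01 := mkstr [:: (0,0,0); (1,1,1)]%N.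
Definition R03 := mkstr [:: (0,0,0); (1,1,1); (0,2,2); (2,0,2); (2,2,0)]%N.
Definition R04 := mkstr [:: (0,0,0); (1,1,1); (2,0,2)]%N.
Definition R05 := mkstr [:: (0,0,0); (1,1,1); (0,2,2)]%N.
Definition R07 := mkstr [:: (0,0,0); (1,1,1); (1,2,2); (2,0,2)]%N.
Definition R23 := mkstr [:: (0,0,0); (0,1,1)]%N.
Definition R25 := mkstr [:: (0,0,0); (1,0,1)]%N.
Definition R28 := mkstr [:: (0,0,0); (1,0,1); (0,2,2); (2,2,1)]%N.
Definition R30 := mkstr [:: (0,0,0); (0,1,1); (2,0,2); (2,2,1)]%N.
Definition R31 := mkstr [:: (0,0,0); (1,0,1); (2,0,2)]%N.
Definition R32 := mkstr [:: (0,0,0); (0,1,1); (0,2,2)]%N.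
Definition R33 := mkstr [:: (0,0,0); (1,0,1); (0,2,2); (2,0,2)]%N.
Definition R36 := mkstr [:: (0,0,0); (0,1,1); (0,2,2); (2,0,2)]%N.

Definition Ralg (k : 'I_13) : Str :=
  nth R01 [:: R01; R03; R04; R05; R07; R23; R25; R28; R30; R31; R32; R33; R36] k.

(* Main.v *)
Require Import Defs.
From mathcomp Require Import all_boot all_algebra.
From mathcomp Require Import mpoly ring.
From mathcomp.real_closed Require Import complex.
From mathcomp Require Import Rstruct.
From Stdlib Require Import Classical FunctionalExtensionality.
Set Implicit Arguments. Unset Strict Implicit. Unset Printing Implicit Defensive.
Import GRing.Theory Num.Theory.
Local Open Scope ring_scope.

(** A structure in the variety is an associative product on the even part A0
    (dimension 2), two multiplicative functionals L, R (e f = L(e) f,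
    f e = R(e) f), possibly zero, and s = f f in A0 with x s = R(x) s and
    s x = L(x) s.  If some x in A0 has x, x^2 independent, A0 is generated by x
    and the structure is read off from the roots of x^3 = a x^2 + b x, with L(x)
    and R(x) equal to 0 or a root; otherwise x y = lambda(x) y for all x, y, or
    x y = lambda(y) x for all x, y, with L, R in {0, lambda}.  This gives 13
    polynomial families whose generic members are the 13 listed algebras, so the
    orbit closures cover the variety.  Each listed algebra has a Zariski
    neighbourhood in the variety contained in its orbit; hence the orbits are
    open and no closure contains another one.  Closures are irreducible because
    an orbit is a polynomial image of {D <> 0} in C^5, any two of whose points
    are joined by a line.  For the dimension, strict inclusions of irreducible
    closed sets raise the number of algebraically independent polynomials, and
    six polynomials in five variables are dependent. *)

(** * Polynomial functions and the Zariski topology *)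

(** Every topological argument is reduced to a polynomial map from an affine space, restricted to
    lines, where a nonzero polynomial in one variable has a nonroot. The obstacle is that the action
    involves the inverse of g, so orbit maps are not polynomial in g; replacing the inverse by the
    adjugate and absorbing the determinant by a root of a scalar cures this over C. The bound 5 is
    the dimension of GL_2 x GL_1. It is attained by R03, whose only automorphisms are f1 -> f1 and
    f1 -> -f1. Openness of the orbits does most of the separating work: an open orbit contained in
    the closure of another orbit must meet it, hence equal it. So the 156 possible inclusions
    between closures need no individual treatment; it is enough that the 13 algebras are pairwise
    non-isomorphic, which five yes-or-no invariants show. The polynomial families contain more than
    the listed algebras (equal or zero roots, zero functionals, R03 with f1 f1 = 0, R28 and R30
    likewise). These are limits of generic members, so they create no further components. *)

Definition polyfun n (f : ('I_n -> C) -> C) : Prop :=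
  exists p : {mpoly C[n]}, forall x, f x = p.@[x].

Lemma polyfun_const n (c : C) : @polyfun n (fun=> c).
Proof. by exists c%:MP => x; rewrite mevalC. Qed.

Lemma polyfun_var n (i : 'I_n) : polyfun (fun x => x i).
Proof. by exists 'X_i => x; rewrite mevalXU. Qed.

Lemma polyfunD n (f g : ('I_n -> C) -> C) :
  polyfun f -> polyfun g -> polyfun (fun x => f x + g x).
Proof. by move=> [p Hp] [q Hq]; exists (p + q) => x; rewrite mevalD Hp Hq. Qed.

Lemma polyfunN n (f : ('I_n -> C) -> C) : polyfun f -> polyfun (fun x => - f x).
Proof. by move=> [p Hp]; exists (- p) => x; rewrite mevalN Hp. Qed.

Lemma polyfunM n (f g : ('I_n -> C) -> C) :
  polyfun f -> polyfun g -> polyfun (fun x => f x * g x).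
Proof. by move=> [p Hp] [q Hq]; exists (p * q) => x; rewrite mevalM Hp Hq. Qed.

Lemma polyfunX n (f : ('I_n -> C) -> C) m : polyfun f -> polyfun (fun x => f x ^+ m).
Proof. by move=> [p Hp]; exists (p ^+ m) => x; rewrite rmorphXn /= Hp. Qed.

Lemma polyfun_sum n (I : finType) (P : pred I) (F : I -> ('I_n -> C) -> C) :
  (forall i, polyfun (F i)) -> polyfun (fun x => \sum_(i | P i) F i x).
Proof.
move=> HF; have [p Hp] := fin_all_exists HF.
exists (\sum_(i | P i) p i) => x.
by rewrite raddf_sum; apply: eq_bigr => i _; apply: Hp.
Qed.

Lemma polyfun_comp n m (f : ('I_m -> C) -> C) (g : ('I_n -> C) -> 'I_m -> C) :
  polyfun f -> (forall i, polyfun (g^~ i)) -> polyfun (fun x => f (g x)).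
Proof.
move=> [p Hp] Hg; have [q Hq] := fin_all_exists Hg.
exists (p \mPo [tuple q i | i < m]) => x.
rewrite comp_mpoly_meval Hp; apply: meval_eq => i.
by rewrite tnth_mktuple Hq.
Qed.

(** This is the passage to one variable: along the line from x to y a polynomial function becomes a
    univariate polynomial, with x at t = 0 and y at t = 1. *)
Lemma polyfun_line n (f : ('I_n -> C) -> C) (x y : 'I_n -> C) : polyfun f ->
  exists q : {poly C}, forall t, q.[t] = f (fun i => x i + t * (y i - x i)).
Proof.
move=> [p Hp].
exists (mmap polyC (fun i => (x i)%:P + (y i - x i) *: 'X) p) => t.
rewrite Hp mevalE /mmap horner_sum; apply: eq_bigr => m _.
rewrite hornerM hornerC /mmap1 horner_prod; congr (_ * _).
by apply: eq_bigr => i _; rewrite horner_exp !hornerE mulrC.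
Qed.

Lemma poly_nonzero_point (q : {poly C}) : q != 0 -> exists t, q.[t] != 0.
Proof.
move=> q0; apply/not_all_not_ex => H; case/negP: q0; apply/eqP.
(* In characteristic zero the naturals below [size q] are [size q] distinct points, one more than
   the degree of q. *)
apply: (@roots_geq_poly_eq0 _ _ [seq i%:R | i <- iota 0 (size q)]).
- apply/allP => t _; rewrite /root; apply/eqP.
  by apply/eqP; apply: negbNE; apply/negP/H.
- rewrite map_inj_uniq ?iota_uniq // => i j /eqP.
  by rewrite eqr_nat => /eqP.
- by rewrite size_map size_iota.
Qed.

Lemma zclosure_sub (A : pset Str) : subs A (zclosure A).
Proof. by move=> x Ax p Hp; apply: Hp. Qed.

Lemma zclosure_mono (A B : pset Str) : subs A B -> subs (zclosure A) (zclosure B).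
Proof. by move=> AB x Ax p Hp; apply: Ax => y /AB; apply: Hp. Qed.

Lemma zclosed_zclosure (A : pset Str) : zclosed (zclosure A).
Proof. by move=> x Hx p Hp; apply: Hx => y; apply; apply: Hp. Qed.

Lemma zclosure_min (A B : pset Str) : zclosed B -> subs A B -> subs (zclosure A) B.
Proof. by move=> Bc AB x Hx; apply: Bc; apply: (zclosure_mono AB). Qed.

Lemma not_zclosure (A : pset Str) x : ~ zclosure A x ->
  exists p : {mpoly C[27]}, vanishes A p /\ p.@[x] != 0.
Proof.
move=> H; apply: NNPP => H1; apply: H => p Hp.
by apply/eqP; apply: negbNE; apply/negP => px; apply: H1; by exists p.
Qed.

Lemma zclosed_polyfun (A : pset Str) x f :
  polyfun f -> (forall y, A y -> f y = 0) -> zclosure A x -> f x = 0.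
Proof. by move=> [p Hp] H Hx; rewrite Hp; apply: Hx => y /H; rewrite Hp. Qed.

(** This puts degenerate members of a family into a closure. On the line from a point x1 with D <> 0
    to x, D restricts to a nonzero polynomial d and p o f to some e; a vanishing p on A forces d * e
    = 0, so e = 0, also at the endpoint x. *)
Lemma zclosure_line n (f : ('I_n -> C) -> Str) (D : ('I_n -> C) -> C) (A : pset Str) :
  (forall i, polyfun (f^~ i)) -> polyfun D ->
  (forall x, D x != 0 -> A (f x)) -> (exists x, D x != 0) ->
  forall x, zclosure A (f x).
Proof.
move=> Hf HD HA [x1 Hx1] x p Hp.
have Hpf : polyfun (fun x => p.@[f x]) by apply: (@polyfun_comp _ _ (fun y => p.@[y])) => //; exists p.
have [q Hq] := polyfun_line x1 x (polyfunM HD Hpf).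
have [d Hd] := polyfun_line x1 x HD.
have [e He] := polyfun_line x1 x Hpf.
have x0 : x1 = (fun i => x1 i + 0 * (x i - x1 i)).
  by apply: functional_extensionality => i; rewrite mul0r addr0.
have xx1 : x = (fun i => x1 i + 1 * (x i - x1 i)).
  by apply: functional_extensionality => i; rewrite mul1r addrC subrK.
have d0 : d != 0 by apply: contraNneq Hx1 => dE; rewrite x0 -Hd dE horner0.
have de : d * e = 0.
  apply/eqP; apply: contraT => /poly_nonzero_point[t].
  rewrite hornerM Hd He mulf_eq0 negb_or => /andP[Dt].
  by rewrite Hp ?eqxx //; apply: HA.
have /eqP : e = 0 by apply/eqP; move/eqP: de; rewrite mulf_eq0 (negPf d0).
by move/eqP => e0; rewrite xx1 -He e0 horner0.
Qed.

(* A reducible set would give polynomials p, q with pq = 0 on it; restrict them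
   to the line of parameters joining a point where p <> 0 to one where q <> 0. *)
Lemma irreducible_param n (f : ('I_n -> C) -> Str) (D : ('I_n -> C) -> C) (A : pset Str) :
  (forall i, polyfun (f^~ i)) -> polyfun D ->
  (forall x, D x != 0 -> A (f x)) -> (exists x, D x != 0) ->
  (forall a, A a -> exists2 x, D x != 0 & a = f x) ->
  irreducible (zclosure A).
Proof.
move=> Hf HD HA [z Dz] Asub; split.
  by exists (f z); apply: zclosure_sub; apply: HA.
move=> Z1 Z2 c1 c2 H.
suff [|] : subs A Z1 \/ subs A Z2.
- by move=> s; left; apply: zclosure_min.
- by move=> s; right; apply: zclosure_min.
apply: NNPP => /not_or_and[/not_all_ex_not[a Ha] /not_all_ex_not[b Hb]].
have [Aa na] := imply_to_and _ _ Ha; have [Ab nb] := imply_to_and _ _ Hb.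
have [p [Hp pa]] := not_zclosure (fun h => na (c1 _ h)).
have [q [Hq qb]] := not_zclosure (fun h => nb (c2 _ h)).
have [x Dx ax] := Asub _ Aa; have [y Dy ay] := Asub _ Ab.
have Hpf : polyfun (fun x => p.@[f x]) by apply: (@polyfun_comp _ _ (fun y => p.@[y])) => //; exists p.
have Hqf : polyfun (fun x => q.@[f x]) by apply: (@polyfun_comp _ _ (fun y => q.@[y])) => //; exists q.
have [d Hd] := polyfun_line x y HD.
have [u Hu] := polyfun_line x y Hpf.
have [v Hv] := polyfun_line x y Hqf.
have x0 : (fun i => x i + 0 * (y i - x i)) = x.
  by apply: functional_extensionality => i; rewrite mul0r addr0.
have x1 : (fun i => x i + 1 * (y i - x i)) = y.
  by apply: functional_extensionality => i; rewrite mul1r addrC subrK.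
have d0 : d != 0 by apply: contraNneq Dx => dE; rewrite -x0 -Hd dE horner0.
have u0 : u != 0 by apply: contraNneq pa => dE; rewrite ax -x0 -Hu dE horner0.
have v0 : v != 0 by apply: contraNneq qb => dE; rewrite ay -x1 -Hv dE horner0.
have /poly_nonzero_point[t] : d * u * v != 0 by rewrite !mulf_neq0.
rewrite !hornerM Hd Hu Hv !mulf_eq0 !negb_or => /andP[/andP[Dt pt] qt].
have /H[/Hp|/Hq] := zclosure_sub (HA _ Dt) => /eqP; exact/negP.
Qed.

(** Induction on the number of closed sets. The union of the remaining ones is closed because a
    point outside all of them is separated by a product of polynomials, one for each set. *)
Lemma irreducible_union n (Y : pset Str) (Z : 'I_n -> pset Str) :
  irreducible Y -> (forall k, zclosed (Z k)) ->
  (forall y, Y y -> exists k, Z k y) -> exists k, subs Y (Z k).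
Proof.
move=> [[y0 Yy0] Yirr]; elim: n Z => [|n IH] Z Zc H.
  by have [[]] := H _ Yy0.
have Uc : zclosed (fun y => exists k, Z (lift ord0 k) y).
  move=> y Hy; apply: NNPP => nex.
  have /fin_all_exists[p Hp] : forall k, exists p : {mpoly C[27]},
      vanishes (Z (lift ord0 k)) p /\ p.@[y] != 0.
    by move=> k; apply: not_zclosure => /(Zc _) Zk; apply: nex; exists k.
  have : (\prod_k p k).@[y] = 0.
    apply: Hy => z [k Zk]; rewrite rmorph_prod (bigD1 k) //= (proj1 (Hp k)) //.
    by rewrite mul0r.
  rewrite rmorph_prod => /eqP; apply/negP/prodf_neq0 => k _; exact: (proj2 (Hp k)).
have [| |] := Yirr (Z ord0) (fun y => exists k, Z (lift ord0 k) y) (Zc _) Uc.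
- move=> y /H[k Zk]; have [k' kE|k0] := unliftP ord0 k; last by left; rewrite -k0.
  by right; exists k'; rewrite -kE.
- by move=> s; exists ord0.
- by case/(IH _ (fun k => Zc _)) => k s; exists (lift ord0 k).
Qed.

(** * Chains and algebraic independence *)

(** [muni] reads P as a univariate polynomial in its last variable; [alg_indep_extend] substitutes
    the new function f for that variable. *)
Lemma meval_muni n (P : {mpoly C[n.+1]}) (v : 'I_n.+1 -> C) :
  P.@[v] = (map_poly (meval (fun i => v (widen_ord (leqnSn n) i))) (muni P)).[v ord_max].
Proof.
rewrite mevalE muniE rmorph_sum /= horner_sum; apply: eq_bigr => m _.
rewrite map_polyZ /= map_polyXn hornerZ hornerXn mevalZ mevalX big_ord_recr /= mulrA.
by congr (_ * _ * _); apply: eq_bigr => i _; rewrite mnmE.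
Qed.

Lemma muni_eq0 n (P : {mpoly C[n.+1]}) : muni P = 0 -> P = 0.
Proof.
move=> P0; apply/mpolyP => m; rewrite mcoeff0; apply/eqP.
have [|] := boolP (m \in msupp P); last by rewrite mcoeff_eq0.
move=> mP.
have := congr1 (fun q : {poly {mpoly C[n]}} =>
  (q`_(m ord_max))@_[multinom m (widen_ord (leqnSn n) i) | i < n]) P0.
rewrite coef0 mcoeff0 muniE coef_sum raddf_sum /= (bigD1_seq m) //= ?msupp_uniq //.
rewrite big1 ?addr0 => [|m' m'm].
  by rewrite coefZ coefXn eqxx mulr1 mcoeffZ mcoeffX eqxx mulr1 => ->.
rewrite coefZ coefXn; have [mE|] := eqVneq (m ord_max) (m' ord_max); last by rewrite mulr0 mcoeff0.
rewrite mulr1 mcoeffZ mcoeffX; case: eqP => [/mnmP H|]; last by rewrite mulr0.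
case/eqP: m'm; apply/mnmP => i; have [im|im] := eqVneq (val i) n.
  by have -> : i = ord_max by apply: val_inj.
have ilt : (i < n)%N by rewrite ltn_neqAle im -ltnS ltn_ord.
have := H (Ordinal ilt); rewrite !mnmE.
by have -> : widen_ord (leqnSn n) (Ordinal ilt) = i by apply: val_inj.
Qed.

(** Independence of the restrictions to A, that is, in the ring of polynomial functions on A;
    testing values avoids forming a quotient ring. *)
Definition alg_indep (A : pset Str) n (y : 'I_n -> {mpoly C[27]}) :=
  forall P : {mpoly C[n]},
    (forall x, A x -> P.@[fun i => (y i).@[x]] = 0) -> P = 0.

Lemma alg_indep_mono (A B : pset Str) n (y : 'I_n -> {mpoly C[27]}) :
  subs A B -> alg_indep A y -> alg_indep B y.
Proof. by move=> AB H P HP; apply: H => x /AB; apply: HP. Qed.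

Lemma irreducible_mul (A : pset Str) (p q : {mpoly C[27]}) : irreducible A ->
  (forall x, A x -> p.@[x] * q.@[x] = 0) -> ~ vanishes A p -> vanishes A q.
Proof.
move=> [_ irr] H np.
have cl r : zclosed (fun x => r.@[x] = 0) by move=> x; apply.
have [||//] := irr _ _ (cl p) (cl q) => // x /H /eqP.
by rewrite mulf_eq0 => /orP[/eqP|/eqP]; [left|right].
Qed.

(* A polynomial f vanishing on the smaller set but not on the larger one can be
   adjoined to an independent family: divide a relation by the highest possible
   power of f and restrict to the smaller set. *)
Lemma alg_indep_extend (A B : pset Str) n (y : 'I_n -> {mpoly C[27]}) :
  zclosed A -> irreducible B -> subs A B -> ~ subs B A -> alg_indep A y ->
  exists y' : 'I_n.+1 -> {mpoly C[27]}, alg_indep B y'.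
Proof.
move=> cA iB AB nBA indA.
have [b Hb] := not_all_ex_not _ _ nBA; have [Bb nAb] := imply_to_and _ _ Hb.
have [f [fA fb]] := not_zclosure (fun h => nAb (cA _ h)).
have nfB : ~ vanishes B f by move=> /(_ _ Bb) /eqP; apply/negP.
exists (fun i => if unlift ord_max i is Some j then y j else f) => P HP.
pose ev x := meval (fun i => (y i).@[x]).
have {}HP x : B x -> (map_poly (ev x) (muni P)).[f.@[x]] = 0.
  move=> /HP <-; rewrite (meval_muni P) /= unlift_none; congr (map_poly _ _).[_].
  apply: functional_extensionality => p; apply: meval_eq => i /=.
  have -> : widen_ord (leqnSn n) i = lift ord_max i by apply: val_inj; rewrite /= /bump leqNgt ltn_ord.
  by rewrite liftK.
apply: muni_eq0; move: (muni P) HP => {P}; elim/poly_ind => // Q c IH HQ.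
have HQ' x : B x -> (map_poly (ev x) Q).[f.@[x]] * f.@[x] + ev x c = 0.
  by move=> /HQ; rewrite rmorphD rmorphM /= map_polyX map_polyC /= hornerD hornerM hornerX hornerC.
have c0 : c = 0.
  by apply: indA => x Ax; have := HQ' _ (AB _ Ax); rewrite fA // mulr0 add0r.
rewrite c0 addr0 IH ?mul0r // => x.
have evf : polyfun (fun x => (map_poly (ev x) Q).[f.@[x]]).
  exists (\sum_(i < size Q) (Q`_i \mPo [tuple y j | j < n]) * f ^+ i) => z.
  rewrite (horner_coef_wide _ (size_poly _ _)) raddf_sum /=; apply: eq_bigr => i _.
  rewrite coef_map /= mevalM rmorphXn /= comp_mpoly_meval; congr (_ * _).
  by apply: meval_eq => j; rewrite tnth_mktuple.
case: evf => q Hq; rewrite Hq; apply: (irreducible_mul iB _ nfB) => z Bz.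
by have := HQ' _ Bz; rewrite c0 /ev meval0 addr0 Hq mulrC.
Qed.

Lemma chain_alg_indep (X : pset Str) n : has_chain X n ->
  exists y : 'I_n -> {mpoly C[27]}, alg_indep X y.
Proof.
move=> [Z [HZ HS]].
suff [y Hy] : exists y : 'I_n -> {mpoly C[27]}, alg_indep (Z n) y.
  by exists y; apply: alg_indep_mono Hy; have [_ []] := HZ _ (leqnn n).
have : forall m, (m <= n)%N -> exists y : 'I_m -> {mpoly C[27]}, alg_indep (Z m) y.
  elim=> [_|m IH mn].
    (* With no variables P is a constant, and it is evaluated at a point of the nonempty bottom set
       of the chain. *)
    exists (fun=> 0) => P HP; have [_ [[[x Zx] _] _]] := HZ _ (leq0n n).
    have PE : P = (P@_0)%:MP.
      apply: msize1_polyC; rewrite msizeE; apply/bigmax_leqP_seq => m _ _.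
      by rewrite mdegE big_ord0.
    by have := HP _ Zx; rewrite PE mevalC => ->; rewrite mpolyC0.
  have [y Hy] := IH (ltnW mn); have [sub nsub] := HS _ mn.
  have [cm _] := HZ _ (ltnW mn); have [_ [im _]] := HZ _ mn.
  exact: alg_indep_extend Hy.
exact.
Qed.

(* Count monomials: those with exponents < N in m variables outnumber the
   monomials available in n < m variables once N is large. *)
Lemma alg_dependent n m (w : 'I_m -> {mpoly C[n]}) : (n < m)%N ->
  exists2 P : {mpoly C[m]}, P != 0 & P \mPo [tuple w i | i < m] = 0.
Proof.
move=> nm.
(* A product of powers of the m polynomials w i, with exponents below N, has all its exponents below
   M. Since M <= (m+1) b N and N > ((m+1) b)^n, one gets M^n < N^(n+1) <= N^m. *)
pose b := (\max_i msize (w i)).+1.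
pose N := ((m.+1 * b) ^ n).+1.
pose M := (m * (N * b)).+1.
have Nb : (M ^ n < N ^ m)%N.
  have wexp k c d : (c <= d -> c ^ k <= d ^ k)%N by case: k => // k h; rewrite leq_exp2r.
  have le1 : (M <= m.+1 * b * N)%N.
    by rewrite -mulnA mulSn [(b * N)%N]mulnC addnC /M -addn1 leq_add2l muln_gt0.
  apply: (@leq_ltn_trans ((m.+1 * b * N) ^ n)%N); first exact: wexp.
  rewrite expnMn; apply: (@leq_trans (N * N ^ n)%N).
    by rewrite ltn_pmul2r ?expn_gt0 // ltnSn.
  by rewrite -expnS leq_pexp2l.
have dM d1 d2 (p q : {mpoly C[n]}) : (msize p <= d1.+1)%N -> (msize q <= d2.+1)%N ->
    (msize (p * q) <= (d1 + d2).+1)%N.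
  have [->|p0] := eqVneq p 0; first by rewrite mul0r msize0.
  have [->|q0] := eqVneq q 0; first by rewrite mulr0 msize0.
  by rewrite msizeM // => h1 h2; rewrite -subn1 leq_subLR add1n -addSn -addnS leq_add.
have dX d k (p : {mpoly C[n]}) : (msize p <= d.+1)%N -> (msize (p ^+ k) <= (k * d).+1)%N.
  by move=> h; elim: k => [|k IH]; rewrite ?msize1 // exprS mulSn; apply: dM.
pose I := {ffun 'I_m -> 'I_N}; pose J := {ffun 'I_n -> 'I_M}.
pose mon k K (e : {ffun 'I_k -> 'I_K}) : 'X_{1..k} := [multinom val (e i) | i < k].
have mon_inj k K : injective (@mon k K).
  move=> e e' /mnmP E; apply/ffunP => i; apply: val_inj.
  by have := E i; rewrite !mnmE.
pose W (e : I) := \prod_i w i ^+ e i.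
have dW e : (msize (W e) <= M)%N.
  have : forall s : seq 'I_m, (msize (\prod_(i <- s) w i ^+ e i) <= (size s * (N * b)).+1)%N.
    elim=> [|i s IH]; first by rewrite big_nil msize1.
    rewrite big_cons mulSn; apply: dM => //.
    apply: (@leq_trans (e i * b).+1); last by rewrite ltnS leq_mul2r ltnW ?orbT.
    by apply: dX; rewrite /b ltnW // ltnS; apply: leqW; apply: leq_bigmax.
  by move/(_ (enum (ordinal m))); rewrite size_enum_ord big_enum.
(* One row for each of the N^m products and one column for each of the M^n monomials: there are more
   rows than columns, and a vector of the left kernel gives the coefficients of the relation. *)
pose A := \matrix_(a < #|I|, c < #|J|) (W (enum_val a))@_(mon _ _ (enum_val c)).
have /rowV0Pn[v /sub_kermxP vA /rV0Pn[a0 va0]] : kermx A != 0.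
  rewrite -mxrank_eq0 mxrank_ker -lt0n subn_gt0.
  by apply: leq_ltn_trans (rank_leq_col A) _; rewrite !card_ffun !card_ord.
exists (\sum_a v 0 a *: 'X_[mon _ _ (enum_val a)]).
  apply: contraNneq va0 => /(congr1 (mcoeff (mon _ _ (enum_val a0)))).
  rewrite mcoeff0 raddf_sum /= (bigD1 a0) //= big1 ?addr0 => [|a aa0].
    by rewrite mcoeffZ mcoeffX eqxx mulr1 => ->.
  rewrite mcoeffZ mcoeffX (inj_eq (@mon_inj _ _)) (inj_eq enum_val_inj) (negPf aa0).
  by rewrite mulr0.
apply/mpolyP => u; rewrite mcoeff0 (raddf_sum (comp_mpoly _)) (raddf_sum (mcoeff u)) /=.
have E a : (v 0 a *: 'X_[mon _ _ (enum_val a)] \mPo [tuple w i | i < m])@_u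
    = v 0 a * (W (enum_val a))@_u.
  rewrite comp_mpolyZ mcoeffZ comp_mpolyX; congr (_ * mcoeff _ _).
  by apply: eq_bigr => i _; rewrite tnth_mktuple mnmE.
rewrite (eq_bigr _ (fun a _ => E a)).
(* Monomials inside the box are controlled by the kernel vector; outside it every coefficient
   vanishes by the degree bound. *)
have [uM|/forallPn[i ui]] := boolP [forall i, (u i < M)%N].
  pose e : J := [ffun i => Ordinal (forallP uM i)].
  have ue : u = mon _ _ e by apply/mnmP => i; rewrite mnmE ffunE.
  have := congr1 (fun B : 'rV_#|J| => B 0 (enum_rank e)) vA.
  rewrite !mxE => vA0; rewrite -[RHS]vA0; apply: eq_bigr => a _; by rewrite !mxE enum_rankK ue.
apply: big1 => a _; have -> : (W (enum_val a))@_u = 0; last by rewrite mulr0.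
apply/eqP; rewrite mcoeff_eq0 msize_mdeg_ge //.
rewrite (leq_trans (dW _)) // mdegE (bigD1 i) //= (leq_trans _ (leq_addr _ _)) //.
by rewrite leqNgt.
Qed.

(** A chain of length n+1 would give n+1 independent functions on the closure. Pulled back along f
    they are n+1 polynomials in n variables, and a relation among the pullbacks holds on A, hence on
    its closure. *)
Lemma param_no_chain n (f : ('I_n -> C) -> Str) (A : pset Str) :
  (forall i, polyfun (f^~ i)) -> (forall a, A a -> exists x, a = f x) ->
  ~ has_chain (zclosure A) n.+1.
Proof.
move=> Hf HA /chain_alg_indep[y Hy].
have [F HF] := fin_all_exists Hf.
pose w i := y i \mPo [tuple F j | j < 27].
have [P /eqP P0 HP] := alg_dependent w (ltnSn n); case: P0; apply: Hy => a Aa.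
have Hyf : polyfun (fun a : Str => P.@[fun i => (y i).@[a]]).
  by apply: (@polyfun_comp _ _ (fun z => P.@[z])) => [|i]; [exists P|exists (y i)].
apply: (zclosed_polyfun Hyf _ Aa) => _ /HA[x ->].
have := congr1 (meval x) HP; rewrite comp_mpoly_meval meval0 => <-.
apply: meval_eq => i; rewrite tnth_mktuple comp_mpoly_meval; apply: meval_eq => j.
by rewrite tnth_mktuple HF.
Qed.

(** * The action on structure constants *)

Definition o0 : 'I_3 := Ordinal (isT : (0 < 3)%N).
Definition o1 : 'I_3 := Ordinal (isT : (1 < 3)%N).
Definition o2 : 'I_3 := Ordinal (isT : (2 < 3)%N).

Lemma sum3 (F : 'I_3 -> C) : \sum_(i < 3) F i = F o0 + F o1 + F o2.
Proof.
rewrite !big_ord_recr big_ord0 /= add0r; congr (F _ + F _ + F _); exact: val_inj.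
Qed.

Lemma ord3P (P : 'I_3 -> Prop) : P o0 -> P o1 -> P o2 -> forall i, P i.
Proof.
move=> h0 h1 h2 [[|[|[|]]] h] //; [move: h0|move: h1|move: h2];
  by congr (P _); apply: val_inj.
Qed.

Definition bv (i : 'I_3) : vec := fun j => (j == i)%:R.
Definition colv (g : 'M[C]_3) (i : 'I_3) : vec := fun k => g k i.

(** Inverse of the encoding [idx]: the three arguments of F are the base 3 digits of the
    coordinate. *)
Definition mkStr (F : 'I_3 -> 'I_3 -> 'I_3 -> C) : Str :=
  fun t => F (inord (t %/ 9)) (inord (t %/ 3 %% 3)) (inord (t %% 3)).

Lemma idxE (i j k : 'I_3) : idx i j k = (i * 9 + j * 3 + k)%N :> nat.
Proof.
rewrite /idx inordK //; move: i j k => [i hi] [j hj] [k hk] /=.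
by case: i hi => [|[|[|]]] //; case: j hj => [|[|[|]]] //; case: k hk => [|[|[|]]].
Qed.

Lemma sc_mkStr F i j k : sc (mkStr F) i j k = F i j k.
Proof.
rewrite /sc /mkStr idxE.
have hk : ((i * 9 + j * 3 + k) %% 3 = k)%N.
  by rewrite (_ : 9 = 3 * 3)%N // mulnA -mulnDl modnMDl modn_small.
have hd : ((i * 9 + j * 3 + k) %/ 3 = i * 3 + j)%N.
  by rewrite (_ : 9 = 3 * 3)%N // mulnA -mulnDl divnMDl // divn_small // addn0.
have hi : ((i * 9 + j * 3 + k) %/ 9 = i)%N.
  by rewrite (_ : 9 = 3 * 3)%N // divnMA hd divnMDl // divn_small // addn0.
by rewrite hi hk hd modnMDl modn_small // !inord_val.
Qed.

Lemma str_ext (mu nu : Str) : (forall i j k, sc mu i j k = sc nu i j k) -> mu = nu.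
Proof.
move=> H; apply: functional_extensionality => t.
have lt3 n : (n %% 3 < 3)%N by rewrite ltn_mod.
have tE : t = idx (inord (t %/ 9)) (inord (t %/ 3 %% 3)) (inord (t %% 3)).
  apply: val_inj; rewrite /= idxE !inordK //; last by rewrite ltn_divLR.
  move: (val t) => m; rewrite (_ : 9 = 3 * 3)%N // divnMA mulnA -mulnDl -divn_eq.
  exact: divn_eq.
by rewrite tE; apply: H.
Qed.

Lemma mult_mxapp mu (g : 'M[C]_3) x y k :
  mult mu (mxapp g x) (mxapp g y) k =
  \sum_(i < 3) \sum_(j < 3) x i * y j * mult mu (colv g i) (colv g j) k.
Proof. rewrite /mult /mxapp /colv !sum3; ring. Qed.

Lemma sc_mult mu i j k : sc mu i j k = mult mu (bv i) (bv j) k.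
Proof.
rewrite /mult (bigD1 i) //= (bigD1 j) //= /bv !eqxx !mul1r big1 => [|j' /negPf ->].
  rewrite big1 ?addr0 // => i' /negPf i'i; apply: big1 => j' _.
  by rewrite i'i !mul0r.
by rewrite mulr0 mul0r.
Qed.

Lemma mxapp_bv g i : mxapp g (bv i) = colv g i.
Proof.
apply: functional_extensionality => k.
rewrite /mxapp (bigD1 i) //= /bv eqxx mulr1 big1 ?addr0 // => j /negPf ->.
by rewrite mulr0.
Qed.

Lemma mxapp_mul a b x : mxapp (a *m b) x = mxapp a (mxapp b x).
Proof.
apply: functional_extensionality => i; rewrite /mxapp.
under eq_bigr => j _ do rewrite mxE big_distrl /=.
rewrite exchange_big /=; apply: eq_bigr => j _.
by rewrite big_distrr /=; apply: eq_bigr => k _; rewrite mulrA.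
Qed.

Lemma mxapp1 x : mxapp 1%:M x = x.
Proof.
apply: functional_extensionality => i; rewrite /mxapp (bigD1 i) //= mxE eqxx mul1r.
by rewrite big1 ?addr0 // => j ji; rewrite mxE eq_sym (negPf ji) mul0r.
Qed.

Lemma mxappB g (u v : vec) k :
  mxapp g (fun i => u i - v i) k = mxapp g u k - mxapp g v k.
Proof. by rewrite /mxapp -sumrB; apply: eq_bigr => i _; rewrite mulrBr. Qed.

Lemma mxappZ g c (u : vec) k : mxapp g (fun i => c * u i) k = c * mxapp g u k.
Proof. by rewrite /mxapp big_distrr /=; apply: eq_bigr => i _; rewrite mulrCA. Qed.

Lemma mxappZl g c (u : vec) k : mxapp (c *: g) u k = c * mxapp g u k.
Proof. by rewrite /mxapp big_distrr /=; apply: eq_bigr => i _; rewrite mxE mulrA. Qed.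

Lemma in_G1 : in_G 1%:M.
Proof.
split; first exact: unitmx1.
by move=> i j; rewrite mxE; case: (i =P j) => [->|]; rewrite ?eqxx.
Qed.

Lemma in_GM g h : in_G g -> in_G h -> in_G (g *m h).
Proof.
move=> [gu g0] [hu h0]; split; first by rewrite unitmx_mul gu.
move=> i j ij; rewrite mxE big1 // => k _.
have [ik|/g0 ->] := eqVneq (deg i) (deg k); last by rewrite mul0r.
by rewrite h0 ?mulr0 // -ik.
Qed.

(** A matrix preserves the grading exactly when it commutes with the parity operator S = diag(1, 1,
    -1), and commuting with S passes to the inverse. At an entry of mixed parity this gives 2 *
    entry = 0. *)
Lemma in_GV g : in_G g -> in_G (invmx g).
Proof.
move=> [gu g0]; split; first by rewrite unitmx_inv.
pose S : 'M[C]_3 := diag_mx (\row_i sgn (deg i)).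
have gS : g *m S = S *m g.
  apply/matrixP => i j; rewrite mul_mx_diag mul_diag_mx !mxE.
  have [->|/g0 ->] := eqVneq (deg i) (deg j); first by rewrite mulrC.
  by rewrite mul0r mulr0.
have Sg : S *m invmx g = invmx g *m S.
  apply: (can_inj (mulKmx gu)); rewrite mulmxA gS -mulmxA mulmxV // mulmx1.
  by rewrite mulmxA mulmxV // mul1mx.
move=> i j ij; have /matrixP/(_ i j) := Sg.
rewrite mul_mx_diag mul_diag_mx !mxE => E.
have : (2%:R : C) * invmx g i j = 0.
  have sij : sgn (deg j) = - sgn (deg i).
    by move: ij; rewrite /sgn; case: (deg i); case: (deg j) => //; rewrite opprK.
  have : sgn (deg i) * (2%:R * invmx g i j) = 0.
    move: E; rewrite sij => E.
    by transitivity (sgn (deg i) * invmx g i j - invmx g i j * - sgn (deg i)); [ring|rewrite E; ring].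
  move=> /eqP; rewrite mulf_eq0 => /orP[|/eqP //].
  by rewrite /sgn; case: (deg i); rewrite ?oppr_eq0 oner_eq0.
by move/eqP; rewrite mulf_eq0 pnatr_eq0 => /eqP.
Qed.

Lemma orbit_refl mu : str_orbit mu mu.
Proof.
by exists 1%:M; split; [exact: in_G1|move=> x y; rewrite invmx1 !mxapp1].
Qed.

Lemma orbit_trans mu nu rho : str_orbit mu nu -> str_orbit nu rho -> str_orbit mu rho.
Proof.
move=> [g [Gg Hg]] [h [Gh Hh]]; exists (h *m g); split; first exact: in_GM.
have E : invmx (h *m g) = invmx g *m invmx h.
  have [[gu _] [hu _]] := (Gg, Gh).
  by apply: invrM; [exact: hu|exact: gu].
by move=> x y; rewrite E Hh Hg -!mxapp_mul.
Qed.

Lemma orbit_sym mu nu : str_orbit mu nu -> str_orbit nu mu.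
Proof.
move=> [g [Gg Hg]]; exists (invmx g); split; first exact: in_GV.
have [gu _] := Gg; move=> x y.
by rewrite invmxK Hg -!mxapp_mul mulVmx // !mxapp1.
Qed.

(** The columns of g form a basis in which [nu] has the multiplication table of [mu]. Isomorphisms
    can thus be checked on nine products, without inverting g. *)
Lemma orbit_of_basis mu nu g : in_G g ->
  (forall i j, mult nu (colv g i) (colv g j) = mxapp g (sc mu i j)) ->
  str_orbit mu nu.
Proof.
move=> Gg H.
have Hg x y : mult nu (mxapp g x) (mxapp g y) = mxapp g (mult mu x y).
  apply: functional_extensionality => k; rewrite mult_mxapp.
  under eq_bigr => i _ do under eq_bigr => j _ do rewrite H.
  by rewrite /mult /mxapp !sum3; ring.
exists g; split=> // x y; have [gu _] := Gg.
by rewrite -Hg -!mxapp_mul mulmxV // !mxapp1.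
Qed.

Definition act g (mu : Str) : Str :=
  mkStr (fun i j => mxapp g (mult mu (colv (invmx g) i) (colv (invmx g) j))).

Lemma orbit_act mu nu : str_orbit mu nu -> exists2 g, in_G g & nu = act g mu.
Proof.
move=> [g [Gg Hg]]; exists g => //; apply: str_ext => i j k.
by rewrite sc_mkStr sc_mult Hg !mxapp_bv.
Qed.

Lemma act_orbit g mu : in_G g -> str_orbit mu (act g mu).
Proof.
move=> Gg; apply/orbit_sym/(@orbit_of_basis _ _ (invmx g)); first exact: in_GV.
move=> i j; have -> : sc (act g mu) i j =
    mxapp g (mult mu (colv (invmx g) i) (colv (invmx g) j)).
  by apply: functional_extensionality => k; rewrite sc_mkStr.
by rewrite -mxapp_mul mulVmx ?mxapp1 //; case: Gg.
Qed.

Lemma polyfun_sc i j k : polyfun (fun mu : Str => sc mu i j k).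
Proof. exact: polyfun_var. Qed.

Lemma polyfun_mult n (m : ('I_n -> C) -> Str) (u v : ('I_n -> C) -> vec) k :
  (forall i j k, polyfun (fun x => sc (m x) i j k)) ->
  (forall i, polyfun (u^~ i)) -> (forall i, polyfun (v^~ i)) ->
  polyfun (fun x => mult (m x) (u x) (v x) k).
Proof.
move=> Hm Hu Hv; apply: polyfun_sum => i; apply: polyfun_sum => j.
by apply: polyfunM => //; apply: polyfunM.
Qed.

Lemma polyfun_mxapp n (g : ('I_n -> C) -> 'M[C]_3) (u : ('I_n -> C) -> vec) k :
  (forall i j, polyfun (fun x => g x i j)) -> (forall i, polyfun (u^~ i)) ->
  polyfun (fun x => mxapp (g x) (u x) k).
Proof. by move=> Hg Hu; apply: polyfun_sum => i; apply: polyfunM. Qed.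

Lemma polyfun_act g t : polyfun (fun mu => act g mu t).
Proof.
apply: polyfun_mxapp => [i j|i]; first exact: polyfun_const.
by apply: polyfun_mult => *; [exact: polyfun_sc|exact: polyfun_const..].
Qed.

Lemma zclosure_act (A : pset Str) g mu : (forall nu, A nu -> A (act g nu)) ->
  zclosure A mu -> zclosure A (act g mu).
Proof.
move=> HA Hmu p Hp.
have Hf : polyfun (fun nu => p.@[act g nu]).
  by apply: (@polyfun_comp _ _ (fun y => p.@[y])) => [|i]; [exists p|exact: polyfun_act].
by apply: (zclosed_polyfun Hf) Hmu => nu /HA; apply: Hp.
Qed.

(** Orbit closures are stable under the group, so a structure may be put into normal form before it
    is degenerated. *)
Lemma zclosure_orbit mu nu nu' :
  zclosure (str_orbit mu) nu -> str_orbit nu nu' -> zclosure (str_orbit mu) nu'.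
Proof.
move=> H /orbit_act[g Gg ->]; apply: zclosure_act H => nu1 H1.
by apply: orbit_trans H1 _; apply: act_orbit.
Qed.

Lemma mxapp_homog g d x : in_G g -> is_homog d x -> is_homog d (mxapp g x).
Proof.
move=> [_ g0] Hx i id; rewrite /mxapp big1 // => j _.
have [ij|/g0 ->] := eqVneq (deg i) (deg j); last by rewrite mul0r.
by rewrite Hx ?mulr0 // -ij.
Qed.

Lemma mult_homog mu dx dy x y : even_str mu -> is_homog dx x -> is_homog dy y ->
  is_homog (dx (+) dy) (mult mu x y).
Proof.
move=> ev Hx Hy k kd; rewrite /mult big1 // => i _; rewrite big1 // => j _.
have [ix|/Hx ->] := eqVneq (deg i) dx; last by rewrite !mul0r.
have [jy|/Hy ->] := eqVneq (deg j) dy; last by rewrite mulr0 mul0r.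
by rewrite ev ?mulr0 // ix jy.
Qed.

Lemma bv_homog i : is_homog (deg i) (bv i).
Proof. by move=> j; rewrite /bv; case: (j =P i) => [->|]; rewrite ?eqxx. Qed.

Lemma BAvar_orbit mu nu : BAvar mu -> str_orbit mu nu -> BAvar nu.
Proof.
move=> [ev ba] [g [Gg Hg]]; have [gu _] := Gg; have GV := in_GV Gg; split.
  move=> i j k; rewrite sc_mult Hg; apply: mxapp_homog => //; apply: mult_homog => //;
  exact/mxapp_homog/bv_homog.
have E x y z k : assocr nu x y z k =
    mxapp g (assocr mu (mxapp (invmx g) x) (mxapp (invmx g) y) (mxapp (invmx g) z)) k.
  by rewrite /assocr mxappB !Hg -!mxapp_mul mulVmx // !mxapp1.
move=> dx dy dz x y z Hx Hy Hz.
have [H1 H2] := ba _ _ _ _ _ _ (mxapp_homog GV Hx) (mxapp_homog GV Hy) (mxapp_homog GV Hz).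
split=> k; rewrite !E -mxappZ; apply: eq_bigr => i _; congr (_ * _); [exact: H1|exact: H2].
Qed.

(** The columns are the new basis vectors: (p, q) and (r, w) in the even part, h in the odd part. *)
Definition gm (p q r w h : C) : 'M[C]_3 :=
  \matrix_(i, j) nth 0 (nth [::] [:: [:: p; r; 0]; [:: q; w; 0]; [:: 0; 0; h]] i) j.

Lemma gm_mul p q r w h p' q' r' w' h' :
  gm p q r w h *m gm p' q' r' w' h' =
  gm (p * p' + r * q') (q * p' + w * q') (p * r' + r * w') (q * r' + w * w') (h * h').
Proof.
apply/matrixP => i j; rewrite !mxE !sum3 !mxE.
by case: i => [[|[|[|]]] ?] //; case: j => [[|[|[|]]] ?] //=; ring.
Qed.

Lemma gm1 : gm 1 0 0 1 1 = 1%:M.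
Proof.
apply/matrixP => i j; rewrite !mxE.
by case: i => [[|[|[|]]] ?] //; case: j => [[|[|[|]]] ?].
Qed.

Lemma gm_in_G p q r w h : p * w - q * r != 0 -> h != 0 -> in_G (gm p q r w h).
Proof.
move=> D h0; split; last first.
  by move=> i j; rewrite mxE; case: i => [[|[|[|]]] ?] //; case: j => [[|[|[|]]] ?].
pose d := p * w - q * r.
have [] // := @mulmx1_unit _ _ (gm p q r w h) (gm (w / d) (- q / d) (- r / d) (p / d) h^-1).
rewrite gm_mul -gm1; congr gm; rewrite /d; field; rewrite ?D ?h0 //.
Qed.

Lemma in_G_gm g : in_G g -> exists p q r w h,
  [/\ g = gm p q r w h, p * w - q * r != 0 & h != 0].
Proof.
move=> Gg.
have E g' : in_G g' -> exists p q r w h, g' = gm p q r w h.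
  move=> [_ g0]; exists (g' o0 o0), (g' o1 o0), (g' o0 o1), (g' o1 o1), (g' o2 o2).
  by apply/matrixP; apply: ord3P; apply: ord3P; rewrite mxE //= g0.
have [p [q [r [w [h gE]]]]] := E _ Gg; exists p, q, r, w, h.
have [p' [q' [r' [w' [h' gE']]]]] := E _ (in_GV Gg).
have := mulmxV (proj1 Gg); rewrite gE' gE gm_mul => /matrixP H.
have := (H o0 o0, H o0 o1, H o1 o0, H o1 o1, H o2 o2).
rewrite !mxE /= => [[[[[H00 H01] H10] H11] H22]]; split=> //.
  apply/eqP => D.
  have : (p * w - q * r) * (p' * w' - q' * r') = 1.
    by transitivity ((p * p' + r * q') * (q * r' + w * w') - (p * r' + r * w') * (q * p' + w * q'));
      [ring|rewrite H00 H01 H10 H11; ring].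
  by rewrite D mul0r => /esym/eqP; rewrite oner_eq0.
by apply/eqP => h0; move: H22; rewrite h0 mul0r => /esym/eqP; rewrite oner_eq0.
Qed.

(* With J = D g^-1, D = det g, the structure J mu(g x, g y) is the transport of
   mu by (D g)^-1; it is polynomial in g, and it reaches the transport by g^-1
   after rescaling g by a fourth root of 1/D. *)
Definition orbit_param (mu : Str) (x : 'I_5 -> C) : Str :=
  let: (p, q, r, w, h) := (x (inord 0), x (inord 1), x (inord 2), x (inord 3), x (inord 4)) in
  mkStr (fun i j => mxapp (gm (w * h) (- q * h) (- r * h) (p * h) (p * w - q * r))
    (mult mu (colv (gm p q r w h) i) (colv (gm p q r w h) j))).

Definition orbit_param_det (x : 'I_5 -> C) : C :=
  (x (inord 0) * x (inord 3) - x (inord 1) * x (inord 2)) * x (inord 4).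

Lemma polyfun_gm n (p q r w h : ('I_n -> C) -> C) i j :
  polyfun p -> polyfun q -> polyfun r -> polyfun w -> polyfun h ->
  polyfun (fun x => gm (p x) (q x) (r x) (w x) (h x) i j).
Proof.
move=> Hp Hq Hr Hw Hh.
suff [f Hf fE] : exists2 f, polyfun f &
    forall x, gm (p x) (q x) (r x) (w x) (h x) i j = f x.
  by case: Hf => P HP; exists P => x; rewrite fE.
have c0 := @polyfun_const n 0.
move: i j; apply: ord3P; apply: ord3P;
  (eexists; last by move=> x; rewrite mxE); assumption.
Qed.

Lemma polyfun_orbit_param mu t : polyfun (fun x => orbit_param mu x t).
Proof.
have V i := @polyfun_var 5 i.
apply: polyfun_mxapp => [i j|k].
  by apply: polyfun_gm => //; repeat (apply: polyfunM || apply: polyfunD || apply: polyfunN).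
apply: polyfun_mult => [*|i|i]; [exact: polyfun_const|exact: polyfun_gm..].
Qed.

Lemma polyfun_orbit_param_det : polyfun orbit_param_det.
Proof.
have V i := @polyfun_var 5 i.
by repeat (apply: polyfunM || apply: polyfunD || apply: polyfunN).
Qed.

Lemma gm_scale c p q r w h : gm (c * p) (c * q) (c * r) (c * w) (c * h) = c *: gm p q r w h.
Proof.
by apply/matrixP; apply: ord3P; apply: ord3P; rewrite !mxE //= mulr0.
Qed.

Lemma colvZ c (g : 'M[C]_3) i : colv (c *: g) i = fun k => c * colv g i k.
Proof. by apply: functional_extensionality => k; rewrite /colv mxE. Qed.

Lemma multZ mu c (x y : vec) k :
  mult mu (fun i => c * x i) (fun i => c * y i) k = c ^+ 2 * mult mu x y k.
Proof. by rewrite /mult !sum3; ring. Qed.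

Lemma mxapp_scalar c x : mxapp (c%:M) x = fun k => c * x k.
Proof.
by apply: functional_extensionality => k; rewrite -scalemx1 mxappZl mxapp1.
Qed.

Lemma gm_adj p q r w h (D := (p * w - q * r) * h) :
  gm p q r w h *m gm (w * h) (- q * h) (- r * h) (p * h) (p * w - q * r) = D%:M.
Proof.
rewrite gm_mul -[D%:M]scalemx1 -gm1 -gm_scale; congr gm; rewrite /D; ring.
Qed.

Lemma orbit_param_orbit mu x : orbit_param_det x != 0 -> str_orbit mu (orbit_param mu x).
Proof.
rewrite /orbit_param_det /orbit_param.
set p := x (inord 0); set q := x (inord 1); set r := x (inord 2); set w := x (inord 3).
set h := x (inord 4) => D0.
set D := (p * w - q * r) * h in D0.
apply: orbit_sym; apply: (@orbit_of_basis _ _ (D *: gm p q r w h)).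
  have := D0; rewrite /D mulf_eq0 negb_or => /andP[d0 h0].
  rewrite -gm_scale; apply: gm_in_G; last by rewrite mulf_neq0.
  have -> : D * p * (D * w) - D * q * (D * r) = D ^+ 2 * (p * w - q * r) by ring.
  by rewrite mulf_neq0 // expf_neq0.
move=> i j; apply: functional_extensionality => k.
rewrite !colvZ multZ mxappZl.
set v := sc _ i j.
have -> : v = mxapp (gm (w * h) (- q * h) (- r * h) (p * h) (p * w - q * r))
    (mult mu (colv (gm p q r w h) i) (colv (gm p q r w h) j)).
  by apply: functional_extensionality => l; rewrite /v sc_mkStr.
by rewrite -mxapp_mul gm_adj mxapp_scalar -/D; ring.
Qed.

Lemma orbit_param_surj mu nu : str_orbit mu nu ->
  exists2 x, orbit_param_det x != 0 & nu = orbit_param mu x.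
Proof.
move=> /orbit_act[g Gg ->].
have [p [q [r [w [h [gE d0 h0]]]]]] := in_G_gm (in_GV Gg).
pose D := (p * w - q * r) * h.
have D0 : D != 0 by rewrite mulf_neq0.
(* The adjugate and mu(g x, g y) both have degree 2 in the matrix, so [orbit_param] is homogeneous
   of degree 4. Scaling by c multiplies it by 1/D, which turns the adjugate into the inverse. *)
pose c : C := 4.-root D^-1.
have c4 : c ^+ 4 = D^-1 by rewrite rootCK.
have c0 : c != 0 by apply: contraNneq D0 => cE; rewrite -invr_eq0 -c4 cE expr0n.
exists (fun i => c * nth 0 [:: p; q; r; w; h] i).
  rewrite /orbit_param_det !inordK //=.
  have -> : (c * p * (c * w) - c * q * (c * r)) * (c * h) = c ^+ 3 * D by rewrite /D; ring.
  by rewrite mulf_neq0 // expf_neq0.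
apply: str_ext => i j k; rewrite /act /orbit_param !sc_mkStr !inordK //= gm_scale gE !colvZ.
set u := mult mu (colv _ i) (colv _ j).
transitivity (c ^+ 2 * mxapp (gm (c * w * (c * h)) (- (c * q) * (c * h)) (- (c * r) * (c * h)) (c * p * (c * h))
      (c * p * (c * w) - c * q * (c * r))) u k); last first.
  rewrite -mxappZ; congr (mxapp _ _ k); apply: functional_extensionality => l.
  by rewrite multZ.
have -> : gm (c * w * (c * h)) (- (c * q) * (c * h)) (- (c * r) * (c * h)) (c * p * (c * h))
      (c * p * (c * w) - c * q * (c * r)) =
    c ^+ 2 *: gm (w * h) (- q * h) (- r * h) (p * h) (p * w - q * r).
  by rewrite -gm_scale; congr gm; ring.
have -> : gm (w * h) (- q * h) (- r * h) (p * h) (p * w - q * r) = D *: g.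
  rewrite -[LHS](mulKmx (proj1 (in_GV Gg))) gE gm_adj -/D mul_mx_scalar.
  by rewrite -gE invmxK.
rewrite !mxappZl mulrA -exprD (_ : c ^+ (2 + 2) = D^-1) //.
by rewrite mulrA mulVf // mul1r.
Qed.

Lemma orbit_param_det_neq0 : exists x, orbit_param_det x != 0.
Proof.
exists (fun i => nth 0 [:: 1; 0; 0; 1; 1] i); rewrite /orbit_param_det !inordK //=.
by rewrite mulr0 subr0 !mulr1 oner_neq0.
Qed.

Lemma irreducible_orbit mu : irreducible (zclosure (str_orbit mu)).
Proof.
apply: (irreducible_param (polyfun_orbit_param mu) polyfun_orbit_param_det).
- exact: orbit_param_orbit.
- exact: orbit_param_det_neq0.
- by move=> a /orbit_param_surj.
Qed.

Lemma orbit_no_chain mu : ~ has_chain (zclosure (str_orbit mu)) 6.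
Proof.
apply: (param_no_chain (polyfun_orbit_param mu)) => a.
by case/orbit_param_surj => x _ ->; exists x.
Qed.

(** The 14 constants allowed by parity: a, b, c, d are the coordinates of e1 e1, e1 e2, e2 e1, e2
    e2; e_i f1 = l_i f1, f1 e_i = r_i f1, and f1 f1 = s1 e1 + s2 e2. *)
Definition S14 (a1 a2 b1 b2 c1 c2 d1 d2 l1 l2 r1 r2 s1 s2 : C) : Str :=
  mkStr (fun i j k => nth 0 (nth [::] (nth [::]
    [:: [:: [:: a1; a2; 0]; [:: b1; b2; 0]; [:: 0; 0; l1]];
        [:: [:: c1; c2; 0]; [:: d1; d2; 0]; [:: 0; 0; l2]];
        [:: [:: 0; 0; r1]; [:: 0; 0; r2]; [:: s1; s2; 0]]] i) j) k).

Lemma even_S14 mu : even_str mu -> mu =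
  S14 (sc mu o0 o0 o0) (sc mu o0 o0 o1) (sc mu o0 o1 o0) (sc mu o0 o1 o1)
      (sc mu o1 o0 o0) (sc mu o1 o0 o1) (sc mu o1 o1 o0) (sc mu o1 o1 o1)
      (sc mu o0 o2 o2) (sc mu o1 o2 o2) (sc mu o2 o0 o2) (sc mu o2 o1 o2)
      (sc mu o2 o2 o0) (sc mu o2 o2 o1).
Proof.
move=> ev; apply: str_ext.
by apply: ord3P; apply: ord3P; apply: ord3P; rewrite sc_mkStr //=; apply: ev.
Qed.

(* The new basis is p e1 + q e2, r e1 + w e2, h f1. *)
Lemma S14_orbit p q r w h a1 a2 b1 b2 c1 c2 d1 d2 l1 l2 r1 r2 s1 s2
    a1' a2' b1' b2' c1' c2' d1' d2' l1' l2' r1' r2' s1' s2'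
    (m1 := fun x1 x2 y1 y2 => x1 * y1 * a1 + x1 * y2 * b1 + x2 * y1 * c1 + x2 * y2 * d1)
    (m2 := fun x1 x2 y1 y2 => x1 * y1 * a2 + x1 * y2 * b2 + x2 * y1 * c2 + x2 * y2 * d2) :
  p * w - q * r != 0 -> h != 0 ->
  m1 p q p q = a1' * p + a2' * r -> m2 p q p q = a1' * q + a2' * w ->
  m1 p q r w = b1' * p + b2' * r -> m2 p q r w = b1' * q + b2' * w ->
  m1 r w p q = c1' * p + c2' * r -> m2 r w p q = c1' * q + c2' * w ->
  m1 r w r w = d1' * p + d2' * r -> m2 r w r w = d1' * q + d2' * w ->
  p * l1 + q * l2 = l1' -> r * l1 + w * l2 = l2' ->
  p * r1 + q * r2 = r1' -> r * r1 + w * r2 = r2' ->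
  h ^+ 2 * s1 = s1' * p + s2' * r -> h ^+ 2 * s2 = s1' * q + s2' * w ->
  str_orbit (S14 a1' a2' b1' b2' c1' c2' d1' d2' l1' l2' r1' r2' s1' s2')
            (S14 a1 a2 b1 b2 c1 c2 d1 d2 l1 l2 r1 r2 s1 s2).
Proof.
move=> D h0 A1 A2 B1 B2 C1 C2 D1 D2 L1 L2 R1 R2 S1 S2.
apply: (@orbit_of_basis _ _ (gm p q r w h)); first exact: gm_in_G.
apply: ord3P; apply: ord3P; apply: functional_extensionality; apply: ord3P;
  rewrite /mult /mxapp /colv !sum3 !sc_mkStr !mxE /=.
- by transitivity (m1 p q p q); [rewrite /m1|rewrite A1]; ring.
- by transitivity (m2 p q p q); [rewrite /m2|rewrite A2]; ring.
- ring.
- by transitivity (m1 p q r w); [rewrite /m1|rewrite B1]; ring.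
- by transitivity (m2 p q r w); [rewrite /m2|rewrite B2]; ring.
- ring.
- ring.
- ring.
- by rewrite -L1; ring.
- by transitivity (m1 r w p q); [rewrite /m1|rewrite C1]; ring.
- by transitivity (m2 r w p q); [rewrite /m2|rewrite C2]; ring.
- ring.
- by transitivity (m1 r w r w); [rewrite /m1|rewrite D1]; ring.
- by transitivity (m2 r w r w); [rewrite /m2|rewrite D2]; ring.
- ring.
- ring.
- ring.
- by rewrite -L2; ring.
- ring.
- ring.
- by rewrite -R1; ring.
- ring.
- ring.
- by rewrite -R2; ring.
- by transitivity (h ^+ 2 * s1); [ring|rewrite S1; ring].
- by transitivity (h ^+ 2 * s2); [ring|rewrite S2; ring].
- ring.
Qed.

(** Structure constants of the associator, a trilinear map. *)
Definition ba (mu : Str) (i j l k : 'I_3) : C :=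
  \sum_(m < 3) sc mu i j m * sc mu m l k - \sum_(m < 3) sc mu j l m * sc mu i m k.

Lemma assocr_sum mu x y z k : assocr mu x y z k =
  \sum_i \sum_j \sum_l x i * y j * z l * ba mu i j l k.
Proof. by rewrite /assocr /ba /mult !sum3; ring. Qed.

Lemma sum_bv i (F : 'I_3 -> C) : \sum_j bv i j * F j = F i.
Proof.
rewrite (bigD1 i) //= /bv eqxx mul1r big1 ?addr0 // => j /negPf ->.
by rewrite mul0r.
Qed.

Lemma assocr_bv mu i j l k : assocr mu (bv i) (bv j) (bv l) k = ba mu i j l k.
Proof.
rewrite assocr_sum -[RHS](sum_bv i (fun i => ba mu i j l k)); apply: eq_bigr => i' _.
rewrite -(sum_bv j (fun j => ba mu i' j l k)) big_distrr /=; apply: eq_bigr => j' _.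
rewrite -(sum_bv l (fun l => ba mu i' j' l k)) !big_distrr /=; apply: eq_bigr => l' _.
by rewrite !mulrA.
Qed.

(** The product x i * y j is zero unless the indices have the degrees of x and y, so the sign in a
    graded identity can be moved inside the sum and read off the indices. *)
Lemma sgn_homog d e (x y : vec) i j : is_homog d x -> is_homog e y ->
  sgn (d && e) * (x i * y j) = sgn (deg i && deg j) * (x i * y j).
Proof.
move=> Hx Hy.
have [->|/Hx ->] := eqVneq (deg i) d; last by rewrite mul0r !mulr0.
by have [->|/Hy ->] := eqVneq (deg j) e; last by rewrite mulr0 !mulr0.
Qed.

Lemma bin_assoc_basis mu :
  (forall i j l k, ba mu i j l k = - sgn (deg j && deg l) * ba mu i l j k /\
                   ba mu i j l k = - sgn (deg i && deg j) * ba mu j i l k) ->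
  bin_assoc mu.
Proof.
move=> H dx dy dz x y z Hx Hy Hz; split=> k; rewrite !assocr_sum.
- rewrite big_distrr /=; apply: eq_bigr => i _.
  rewrite exchange_big big_distrr /=; apply: eq_bigr => l _.
  rewrite big_distrr /=; apply: eq_bigr => j _.
  have := sgn_homog j l Hy Hz; rewrite (proj1 (H i j l k)) => E.
  transitivity (- (sgn (deg j && deg l) * (y j * z l)) * x i * ba mu i l j k); first by ring.
  by rewrite -E; ring.
- rewrite exchange_big big_distrr /=; apply: eq_bigr => j _.
  rewrite big_distrr /=; apply: eq_bigr => i _.
  rewrite big_distrr /=; apply: eq_bigr => l _.
  have := sgn_homog i j Hx Hy; rewrite (proj2 (H i j l k)) => E.
  transitivity (- (sgn (deg i && deg j) * (x i * y j)) * z l * ba mu j i l k); first by ring.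
  by rewrite -E; ring.
Qed.

(** * The equations of the variety *)

(** In [assijlk] the digits mean coordinate k of (e_i e_j) e_l = e_i (e_j e_l). [lmulij] and
    [rmulij] say that L and R are multiplicative on e_i e_j. With s = f1 f1, [lsik] and [rsik] are
    coordinate k of e_i s = R(e_i) s and of s e_i = L(e_i) s. *)
Record S14_law (a1 a2 b1 b2 c1 c2 d1 d2 l1 l2 r1 r2 s1 s2 : C) : Prop := {
  ass1111 : a1 * a1 + a2 * c1 = a1 * a1 + a2 * b1;
  ass1112 : a1 * a2 + a2 * c2 = a1 * a2 + a2 * b2;
  ass1121 : a1 * b1 + a2 * d1 = b1 * a1 + b2 * b1;
  ass1122 : a1 * b2 + a2 * d2 = b1 * a2 + b2 * b2;
  ass1211 : b1 * a1 + b2 * c1 = c1 * a1 + c2 * b1;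
  ass1212 : b1 * a2 + b2 * c2 = c1 * a2 + c2 * b2;
  ass1221 : b1 * b1 + b2 * d1 = d1 * a1 + d2 * b1;
  ass1222 : b1 * b2 + b2 * d2 = d1 * a2 + d2 * b2;
  ass2111 : c1 * a1 + c2 * c1 = a1 * c1 + a2 * d1;
  ass2112 : c1 * a2 + c2 * c2 = a1 * c2 + a2 * d2;
  ass2121 : c1 * b1 + c2 * d1 = b1 * c1 + b2 * d1;
  ass2122 : c1 * b2 + c2 * d2 = b1 * c2 + b2 * d2;
  ass2211 : d1 * a1 + d2 * c1 = c1 * c1 + c2 * d1;
  ass2212 : d1 * a2 + d2 * c2 = c1 * c2 + c2 * d2;
  ass2221 : d1 * b1 + d2 * d1 = d1 * c1 + d2 * d1;
  ass2222 : d1 * b2 + d2 * d2 = d1 * c2 + d2 * d2;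
  lmul11 : a1 * l1 + a2 * l2 = l1 * l1;
  lmul12 : b1 * l1 + b2 * l2 = l1 * l2;
  lmul21 : c1 * l1 + c2 * l2 = l2 * l1;
  lmul22 : d1 * l1 + d2 * l2 = l2 * l2;
  rmul11 : a1 * r1 + a2 * r2 = r1 * r1;
  rmul12 : b1 * r1 + b2 * r2 = r1 * r2;
  rmul21 : c1 * r1 + c2 * r2 = r2 * r1;
  rmul22 : d1 * r1 + d2 * r2 = r2 * r2;
  ls11 : s1 * a1 + s2 * b1 = r1 * s1;
  ls12 : s1 * a2 + s2 * b2 = r1 * s2;
  ls21 : s1 * c1 + s2 * d1 = r2 * s1;
  ls22 : s1 * c2 + s2 * d2 = r2 * s2;
  rs11 : s1 * a1 + s2 * c1 = l1 * s1;
  rs12 : s1 * a2 + s2 * c2 = l1 * s2;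
  rs21 : s1 * b1 + s2 * d1 = l2 * s1;
  rs22 : s1 * b2 + s2 * d2 = l2 * s2 }.

(** On even arguments the associator alternates, and among three vectors of the basis e1, e2 two
    coincide, so it vanishes ([A]). Even elements act on the odd line by scalars, so (x, f, y) = 0
    ([M]); the identities carry this to (x, y, f) and (f, x, y), which is the multiplicativity of L
    and R. The sums (x, f, f) + (f, x, f) and (f, x, f) + (f, f, x) equal R(x) s - x s and s x -
    L(x) s. *)
Lemma BAvar_S14_law a1 a2 b1 b2 c1 c2 d1 d2 l1 l2 r1 r2 s1 s2 :
  BAvar (S14 a1 a2 b1 b2 c1 c2 d1 d2 l1 l2 r1 r2 s1 s2) ->
  S14_law a1 a2 b1 b2 c1 c2 d1 d2 l1 l2 r1 r2 s1 s2.
Proof.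
move=> [_ H]; set mu := S14 _ _ _ _ _ _ _ _ _ _ _ _ _ _ in H.
have sym i j l k : ba mu i j l k = - sgn (deg j && deg l) * ba mu i l j k /\
                   ba mu i j l k = - sgn (deg i && deg j) * ba mu j i l k.
  have [H1 H2] := H _ _ _ _ _ _ (@bv_homog i) (@bv_homog j) (@bv_homog l).
  by rewrite -!assocr_bv.
have sr i j l k : ~~ (deg j && deg l) -> ba mu i j l k = - ba mu i l j k.
  by move=> d; rewrite (proj1 (sym _ _ _ _)) (negPf d) mulN1r.
have sl i j l k : ~~ (deg i && deg j) -> ba mu i j l k = - ba mu j i l k.
  by move=> d; rewrite (proj2 (sym _ _ _ _)) (negPf d) mulN1r.
have self (x : C) : x = - x -> x = 0.
  move/eqP; rewrite -addr_eq0 -mulr2n -mulr_natl mulf_eq0 pnatr_eq0 => /eqP //.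
have A i j l k : ~~ deg i -> ~~ deg j -> ~~ deg l -> ba mu i j l k = 0.
  move=> di dj dl.
  have altr a b c : ~~ deg b -> ba mu a b b c = 0.
    by move=> d; apply: self; rewrite {1}sr // andbb.
  have altl a b c : ~~ deg a -> ba mu a a b c = 0.
    by move=> d; apply: self; rewrite {1}sl // andbb.
  have [<-|ij] := eqVneq i j; first exact: altl.
  have [<-|jl] := eqVneq j l; first exact: altr.
  have <- : i = l.
    by move: di dj dl ij jl; move: i j l; apply: ord3P; apply: ord3P; apply: ord3P.
  by rewrite sr ?altl ?oppr0 // (negPf di) andbF.
have M i j : ~~ deg i -> ~~ deg j -> ba mu i o2 j o2 = 0.
  by move: i j; apply: ord3P; apply: ord3P => // _ _; rewrite /ba !sum3 !sc_mkStr /=; ring.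
have L i j : ~~ deg i -> ~~ deg j -> ba mu i j o2 o2 = 0.
  by move=> di dj; rewrite sr ?M ?oppr0 // (negPf dj).
have R i j : ~~ deg i -> ~~ deg j -> ba mu o2 i j o2 = 0.
  by move=> di dj; rewrite sl ?M ?oppr0 // (negPf di).
have X i k : ~~ deg i -> ba mu i o2 o2 k + ba mu o2 i o2 k = 0.
  by move=> di; rewrite sl ?addNr // (negPf di).
have Y i k : ~~ deg i -> ba mu o2 i o2 k + ba mu o2 o2 i k = 0.
  by move=> di; rewrite sr ?addNr // (negPf di).
split.
- by apply: subr0_eq; have := A o0 o0 o0 o0 isT isT isT; rewrite /ba !sum3 !sc_mkStr /= => E; rewrite -[in RHS]E; ring.
- by apply: subr0_eq; have := A o0 o0 o0 o1 isT isT isT; rewrite /ba !sum3 !sc_mkStr /= => E; rewrite -[in RHS]E; ring.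
- by apply: subr0_eq; have := A o0 o0 o1 o0 isT isT isT; rewrite /ba !sum3 !sc_mkStr /= => E; rewrite -[in RHS]E; ring.
- by apply: subr0_eq; have := A o0 o0 o1 o1 isT isT isT; rewrite /ba !sum3 !sc_mkStr /= => E; rewrite -[in RHS]E; ring.
- by apply: subr0_eq; have := A o0 o1 o0 o0 isT isT isT; rewrite /ba !sum3 !sc_mkStr /= => E; rewrite -[in RHS]E; ring.
- by apply: subr0_eq; have := A o0 o1 o0 o1 isT isT isT; rewrite /ba !sum3 !sc_mkStr /= => E; rewrite -[in RHS]E; ring.
- by apply: subr0_eq; have := A o0 o1 o1 o0 isT isT isT; rewrite /ba !sum3 !sc_mkStr /= => E; rewrite -[in RHS]E; ring.
- by apply: subr0_eq; have := A o0 o1 o1 o1 isT isT isT; rewrite /ba !sum3 !sc_mkStr /= => E; rewrite -[in RHS]E; ring.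
- by apply: subr0_eq; have := A o1 o0 o0 o0 isT isT isT; rewrite /ba !sum3 !sc_mkStr /= => E; rewrite -[in RHS]E; ring.
- by apply: subr0_eq; have := A o1 o0 o0 o1 isT isT isT; rewrite /ba !sum3 !sc_mkStr /= => E; rewrite -[in RHS]E; ring.
- by apply: subr0_eq; have := A o1 o0 o1 o0 isT isT isT; rewrite /ba !sum3 !sc_mkStr /= => E; rewrite -[in RHS]E; ring.
- by apply: subr0_eq; have := A o1 o0 o1 o1 isT isT isT; rewrite /ba !sum3 !sc_mkStr /= => E; rewrite -[in RHS]E; ring.
- by apply: subr0_eq; have := A o1 o1 o0 o0 isT isT isT; rewrite /ba !sum3 !sc_mkStr /= => E; rewrite -[in RHS]E; ring.
- by apply: subr0_eq; have := A o1 o1 o0 o1 isT isT isT; rewrite /ba !sum3 !sc_mkStr /= => E; rewrite -[in RHS]E; ring.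
- by apply: subr0_eq; have := A o1 o1 o1 o0 isT isT isT; rewrite /ba !sum3 !sc_mkStr /= => E; rewrite -[in RHS]E; ring.
- by apply: subr0_eq; have := A o1 o1 o1 o1 isT isT isT; rewrite /ba !sum3 !sc_mkStr /= => E; rewrite -[in RHS]E; ring.
- by apply: subr0_eq; have := L o0 o0 isT isT; rewrite /ba !sum3 !sc_mkStr /= => E; rewrite -[in RHS]E; ring.
- by apply: subr0_eq; have := L o0 o1 isT isT; rewrite /ba !sum3 !sc_mkStr /= => E; rewrite -[in RHS]E; ring.
- by apply: subr0_eq; have := L o1 o0 isT isT; rewrite /ba !sum3 !sc_mkStr /= => E; rewrite -[in RHS]E; ring.
- by apply: subr0_eq; have := L o1 o1 isT isT; rewrite /ba !sum3 !sc_mkStr /= => E; rewrite -[in RHS]E; ring.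
- by apply: subr0_eq; have := R o0 o0 isT isT; rewrite /ba !sum3 !sc_mkStr /= => E; rewrite -[RHS]oppr0 -[in RHS]E; ring.
- by apply: subr0_eq; have := R o0 o1 isT isT; rewrite /ba !sum3 !sc_mkStr /= => E; rewrite -[RHS]oppr0 -[in RHS]E; ring.
- by apply: subr0_eq; have := R o1 o0 isT isT; rewrite /ba !sum3 !sc_mkStr /= => E; rewrite -[RHS]oppr0 -[in RHS]E; ring.
- by apply: subr0_eq; have := R o1 o1 isT isT; rewrite /ba !sum3 !sc_mkStr /= => E; rewrite -[RHS]oppr0 -[in RHS]E; ring.
- by apply: subr0_eq; have := X o0 o0 isT; rewrite /ba !sum3 !sc_mkStr /= => E; rewrite -[RHS]oppr0 -[in RHS]E; ring.
- by apply: subr0_eq; have := X o0 o1 isT; rewrite /ba !sum3 !sc_mkStr /= => E; rewrite -[RHS]oppr0 -[in RHS]E; ring.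
- by apply: subr0_eq; have := X o1 o0 isT; rewrite /ba !sum3 !sc_mkStr /= => E; rewrite -[RHS]oppr0 -[in RHS]E; ring.
- by apply: subr0_eq; have := X o1 o1 isT; rewrite /ba !sum3 !sc_mkStr /= => E; rewrite -[RHS]oppr0 -[in RHS]E; ring.
- by apply: subr0_eq; have := Y o0 o0 isT; rewrite /ba !sum3 !sc_mkStr /= => E; rewrite -[in RHS]E; ring.
- by apply: subr0_eq; have := Y o0 o1 isT; rewrite /ba !sum3 !sc_mkStr /= => E; rewrite -[in RHS]E; ring.
- by apply: subr0_eq; have := Y o1 o0 isT; rewrite /ba !sum3 !sc_mkStr /= => E; rewrite -[in RHS]E; ring.
- by apply: subr0_eq; have := Y o1 o1 isT; rewrite /ba !sum3 !sc_mkStr /= => E; rewrite -[in RHS]E; ring.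
Qed.

(** * Verification that the listed algebras lie in the variety *)

Definition table (l : seq (nat * nat * nat)) (i j k : nat) : nat :=
  ((i * 9 + j * 3 + k)%N \in [seq (p.1.1 * 9 + p.1.2 * 3 + p.2)%N | p <- l]).

Definition tsum (F : nat -> nat) : nat := (F 0 + F 1 + F 2)%N.

Definition tpos l i j m k : nat := tsum (fun t => table l i j t * table l t m k)%N.
Definition tneg l i j m k : nat := tsum (fun t => table l j m t * table l i t k)%N.

(** The relation p - n = p' - n' for b true, and p - n = - (p' - n') for b false, with the terms
    moved so that no natural numbers are subtracted. *)
Definition tsuper (b : bool) (p n p' n' : nat) : bool :=
  if b then (p + n' == p' + n)%N else (p + p' == n + n')%N.

(** All structure constants are 0 or 1, so an associator is a difference of two naturals and the
    identities can be decided by computation. *)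
Definition alternative_table (l : seq (nat * nat * nat)) : bool :=
  let r := iota 0 3 in let odd i := (i == 2)%N in
  all (fun i => all (fun j => all (fun k =>
    ((odd k == (odd i (+) odd j)) || (table l i j k == 0)%N) &&
    all (fun m =>
      tsuper (odd j && odd m) (tpos l i j m k) (tneg l i j m k) (tpos l i m j k) (tneg l i m j k) &&
      tsuper (odd i && odd j) (tpos l i j m k) (tneg l i j m k) (tpos l j i m k) (tneg l j i m k))
    r) r) r) r.

Lemma sc_mkstr l i j k : sc (mkstr l) i j k = (table l i j k)%:R.
Proof.
rewrite /sc /mkstr /table -idxE; change (val (idx i j k)) with (nat_of_ord (idx i j k)).
by case: (_ \in _).
Qed.

Lemma BAvar_mkstr l : alternative_table l -> BAvar (mkstr l).
Proof.
move=> /allP H.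
have I (i : 'I_3) : val i \in iota 0 3 by rewrite mem_iota /= add0n ltn_ord.
have {}H (i j k : 'I_3) := allP (allP (H _ (I i)) _ (I j)) _ (I k).
split.
  move=> i j k d; rewrite sc_mkstr.
  have /andP[/orP[/eqP E|/eqP -> //] _] := H i j k; case/eqP: d; exact: E.
have baE i j m k : ba (mkstr l) i j m k = (tpos l i j m k)%:R - (tneg l i j m k)%:R.
  by rewrite /ba !sum3 !sc_mkstr /tpos /tneg /tsum !natrD !natrM.
have S b p n p' n' : tsuper b p n p' n' ->
    (p%:R - n%:R : C) = - sgn b * (p'%:R - n'%:R).
  rewrite /tsuper /sgn; case: b => /eqP /(congr1 (fun t => t%:R : C)); rewrite !natrD => E.
    by rewrite opprK mul1r; apply/eqP; rewrite subr_eq addrAC eq_sym subr_eq eq_sym E.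
  by rewrite mulN1r opprB; apply/eqP; rewrite subr_eq addrAC eq_sym subr_eq eq_sym E addrC.
apply: bin_assoc_basis => i j m k; rewrite !baE.
have /andP[_ /allP /(_ _ (I m)) /andP[H1 H2]] := H i j k.
by split; [apply: (S _ _ _ _ _ H1)|apply: (S _ _ _ _ _ H2)].
Qed.

Lemma BAvar_Ralg k : BAvar (Ralg k).
Proof.
by case: k => [[|[|[|[|[|[|[|[|[|[|[|[|[|]]]]]]]]]]]]] h] //; apply: BAvar_mkstr; vm_compute.
Qed.

Lemma mkstr_S14 l : even_str (mkstr l) -> mkstr l =
  let t i j k := (table l i j k)%:R in
  S14 (t 0 0 0) (t 0 0 1) (t 0 1 0) (t 0 1 1) (t 1 0 0) (t 1 0 1) (t 1 1 0) (t 1 1 1)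
      (t 0 2 2) (t 1 2 2) (t 2 0 2) (t 2 1 2) (t 2 2 0) (t 2 2 1).
Proof. by move=> ev; rewrite {1}(even_S14 ev) !sc_mkstr. Qed.

(** Indices are positions in the list of [Ralg], not labels: 1 is R03, 7 is R28, 8 is R30. *)
Definition Rtable (k : nat) : Str := nth R01
  [:: S14 1 0 0 0 0 0 0 1 0 0 0 0 0 0;
      S14 1 0 0 0 0 0 0 1 1 0 1 0 1 0;
      S14 1 0 0 0 0 0 0 1 0 0 1 0 0 0;
      S14 1 0 0 0 0 0 0 1 1 0 0 0 0 0;
      S14 1 0 0 0 0 0 0 1 0 1 1 0 0 0;
      S14 1 0 0 1 0 0 0 0 0 0 0 0 0 0;
      S14 1 0 0 0 0 1 0 0 0 0 0 0 0 0;
      S14 1 0 0 0 0 1 0 0 1 0 0 0 0 1;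
      S14 1 0 0 1 0 0 0 0 0 0 1 0 0 1;
      S14 1 0 0 0 0 1 0 0 0 0 1 0 0 0;
      S14 1 0 0 1 0 0 0 0 1 0 0 0 0 0;
      S14 1 0 0 0 0 1 0 0 1 0 1 0 0 0;
      S14 1 0 0 1 0 0 0 0 1 0 1 0 0 0] k.

Lemma RalgE (k : 'I_13) : Ralg k = Rtable k.
Proof.
have [ev _] := BAvar_Ralg k.
by move: ev; case: k => [[|[|[|[|[|[|[|[|[|[|[|[|[|]]]]]]]]]]]]] h] // ev; exact: (mkstr_S14 ev).
Qed.

Ltac polyfun_tac := lazymatch goal with
  | |- polyfun (fun _ => ?c) => exact: polyfun_const
  | |- polyfun (fun x => @?f x + @?g x) => apply (@polyfunD _ f g); polyfun_tac
  | |- polyfun (fun x => - @?f x) => apply (@polyfunN _ f); polyfun_tac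
  | |- polyfun (fun x => @?f x * @?g x) => apply (@polyfunM _ f g); polyfun_tac
  | |- polyfun (fun x => @?f x ^+ ?m) => apply (@polyfunX _ f m); polyfun_tac
  | |- polyfun (fun x => sc x _ _ _) => exact: polyfun_sc
  | |- polyfun _ => first [assumption | exact: polyfun_var]
  end.

Lemma polyfun_S14 n (a1 a2 b1 b2 c1 c2 d1 d2 l1 l2 r1 r2 s1 s2 : ('I_n -> C) -> C) t :
  polyfun a1 -> polyfun a2 -> polyfun b1 -> polyfun b2 -> polyfun c1 -> polyfun c2 ->
  polyfun d1 -> polyfun d2 -> polyfun l1 -> polyfun l2 -> polyfun r1 -> polyfun r2 ->
  polyfun s1 -> polyfun s2 ->
  polyfun (fun x => S14 (a1 x) (a2 x) (b1 x) (b2 x) (c1 x) (c2 x) (d1 x) (d2 x)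
                        (l1 x) (l2 x) (r1 x) (r2 x) (s1 x) (s2 x) t).
Proof.
move=> *; rewrite /S14 /mkStr.
move: (inord (t %/ 9)) (inord (t %/ 3 %% 3)) (inord (t %% 3)).
by apply: ord3P; apply: ord3P; apply: ord3P => /=; polyfun_tac.
Qed.

(** The even basis is x, x^2 with x^3 = a x^2 + b x, where rho and rho' are the roots of z^2 = a z +
    b. Further L(x) = l, R(x) = r and f1 f1 = u x + v x^2. *)
Definition Fc rho rho' l r u v : Str :=
  let: (a, b) := (rho + rho', - (rho * rho')) in
  S14 0 1 b a b a (a * b) (a ^+ 2 + b) l (l ^+ 2) r (r ^+ 2) u v.

(** For distinct nonzero roots the new basis consists of the Lagrange idempotents E1 = x (x - rho')
    / (rho (rho - rho')) and E2 = x (x - rho) / (rho' (rho' - rho)). The hypotheses on l and r are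
    the values of L and R at E1 and E2, cleared of denominators. *)
Lemma Fc_orbit rho rho' l r u v h l1' l2' r1' r2' s1' s2' :
  rho != 0 -> rho' != 0 -> rho != rho' -> h != 0 ->
  l * (l - rho') = rho * (rho - rho') * l1' -> l * (l - rho) = rho' * (rho' - rho) * l2' ->
  r * (r - rho') = rho * (rho - rho') * r1' -> r * (r - rho) = rho' * (rho' - rho) * r2' ->
  h ^+ 2 * u = - rho' * s1' / (rho * (rho - rho')) - rho * s2' / (rho' * (rho' - rho)) ->
  h ^+ 2 * v = s1' / (rho * (rho - rho')) + s2' / (rho' * (rho' - rho)) ->
  str_orbit (S14 1 0 0 0 0 0 0 1 l1' l2' r1' r2' s1' s2') (Fc rho rho' l r u v).
Proof.
move=> n0 n1 n2 h0 L1 L2 R1 R2 S1 S2; rewrite -subr_eq0 in n2.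
have n3 : rho' - rho != 0 by rewrite -opprB oppr_eq0.
have nn1 : rho * (rho - rho') != 0 by rewrite mulf_neq0.
have nn2 : rho' * (rho' - rho) != 0 by rewrite mulf_neq0.
apply: (@S14_orbit (- rho' / (rho * (rho - rho'))) (rho * (rho - rho'))^-1
   (- rho / (rho' * (rho' - rho))) (rho' * (rho' - rho))^-1 h) => //.
- have -> : - rho' / (rho * (rho - rho')) / (rho' * (rho' - rho))
    - (rho * (rho - rho'))^-1 * (- rho / (rho' * (rho' - rho))) =
    (rho * (rho' * (rho' - rho)))^-1 by field; rewrite ?n0 ?n1 ?n2 ?n3.
  by rewrite invr_eq0 mulf_neq0.
- by field; rewrite ?n0 ?n1 ?n2 ?n3.
- by field; rewrite ?n0 ?n1 ?n2 ?n3.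
- by field; rewrite ?n0 ?n1 ?n2 ?n3.
- by field; rewrite ?n0 ?n1 ?n2 ?n3.
- by field; rewrite ?n0 ?n1 ?n2 ?n3.
- by field; rewrite ?n0 ?n1 ?n2 ?n3.
- by field; rewrite ?n0 ?n1 ?n2 ?n3.
- by field; rewrite ?n0 ?n1 ?n2 ?n3.
- by apply: (mulfI nn1); rewrite -L1; field; rewrite ?n0 ?n1 ?n2 ?n3.
- by apply: (mulfI nn2); rewrite -L2; field; rewrite ?n0 ?n1 ?n2 ?n3.
- by apply: (mulfI nn1); rewrite -R1; field; rewrite ?n0 ?n1 ?n2 ?n3.
- by apply: (mulfI nn2); rewrite -R2; field; rewrite ?n0 ?n1 ?n2 ?n3.
- by rewrite S1; field; rewrite ?n0 ?n1 ?n2 ?n3.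
Qed.

(** * The two-dimensional associative even part *)

Section EvenPart.
Variables (a1 a2 b1 b2 c1 c2 d1 d2 : C).
Definition mul1 x1 x2 y1 y2 : C := x1 * y1 * a1 + x1 * y2 * b1 + x2 * y1 * c1 + x2 * y2 * d1.
Definition mul2 x1 x2 y1 y2 : C := x1 * y1 * a2 + x1 * y2 * b2 + x2 * y1 * c2 + x2 * y2 * d2.
(** Determinant of the pair x, x^2: nonzero exactly when x generates the even part. *)
Definition sqdet x1 x2 : C := x1 * mul2 x1 x2 x1 x2 - x2 * mul1 x1 x2 x1 x2.

Variables (l1 l2 r1 r2 s1 s2 : C).
Hypothesis law : S14_law a1 a2 b1 b2 c1 c2 d1 d2 l1 l2 r1 r2 s1 s2.

Lemma mul1A x1 x2 y1 y2 z1 z2 :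
  mul1 (mul1 x1 x2 y1 y2) (mul2 x1 x2 y1 y2) z1 z2 =
  mul1 x1 x2 (mul1 y1 y2 z1 z2) (mul2 y1 y2 z1 z2).
Proof.
transitivity (x1 * y1 * z1 * (a1 * a1 + a2 * c1) + x1 * y1 * z2 * (a1 * b1 + a2 * d1)
 + x1 * y2 * z1 * (b1 * a1 + b2 * c1) + x1 * y2 * z2 * (b1 * b1 + b2 * d1)
 + x2 * y1 * z1 * (c1 * a1 + c2 * c1) + x2 * y1 * z2 * (c1 * b1 + c2 * d1)
 + x2 * y2 * z1 * (d1 * a1 + d2 * c1) + x2 * y2 * z2 * (d1 * b1 + d2 * d1)).
  by rewrite /mul1 /mul2; ring.
rewrite (ass1111 law) (ass1121 law) (ass1211 law) (ass1221 law).
rewrite (ass2111 law) (ass2121 law) (ass2211 law) (ass2221 law).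
by rewrite /mul1 /mul2; ring.
Qed.

Lemma mul2A x1 x2 y1 y2 z1 z2 :
  mul2 (mul1 x1 x2 y1 y2) (mul2 x1 x2 y1 y2) z1 z2 =
  mul2 x1 x2 (mul1 y1 y2 z1 z2) (mul2 y1 y2 z1 z2).
Proof.
transitivity (x1 * y1 * z1 * (a1 * a2 + a2 * c2) + x1 * y1 * z2 * (a1 * b2 + a2 * d2)
 + x1 * y2 * z1 * (b1 * a2 + b2 * c2) + x1 * y2 * z2 * (b1 * b2 + b2 * d2)
 + x2 * y1 * z1 * (c1 * a2 + c2 * c2) + x2 * y1 * z2 * (c1 * b2 + c2 * d2)
 + x2 * y2 * z1 * (d1 * a2 + d2 * c2) + x2 * y2 * z2 * (d1 * b2 + d2 * d2)).
  by rewrite /mul1 /mul2; ring.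
rewrite (ass1112 law) (ass1122 law) (ass1212 law) (ass1222 law).
rewrite (ass2112 law) (ass2122 law) (ass2212 law) (ass2222 law).
by rewrite /mul1 /mul2; ring.
Qed.

Lemma lmul_mul x1 x2 y1 y2 :
  mul1 x1 x2 y1 y2 * l1 + mul2 x1 x2 y1 y2 * l2 = (x1 * l1 + x2 * l2) * (y1 * l1 + y2 * l2).
Proof.
transitivity (x1 * y1 * (a1 * l1 + a2 * l2) + x1 * y2 * (b1 * l1 + b2 * l2)
  + x2 * y1 * (c1 * l1 + c2 * l2) + x2 * y2 * (d1 * l1 + d2 * l2)).
  by rewrite /mul1 /mul2; ring.
by rewrite (lmul11 law) (lmul12 law) (lmul21 law) (lmul22 law); ring.
Qed.

Lemma rmul_mul x1 x2 y1 y2 :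
  mul1 x1 x2 y1 y2 * r1 + mul2 x1 x2 y1 y2 * r2 = (x1 * r1 + x2 * r2) * (y1 * r1 + y2 * r2).
Proof.
transitivity (x1 * y1 * (a1 * r1 + a2 * r2) + x1 * y2 * (b1 * r1 + b2 * r2)
  + x2 * y1 * (c1 * r1 + c2 * r2) + x2 * y2 * (d1 * r1 + d2 * r2)).
  by rewrite /mul1 /mul2; ring.
by rewrite (rmul11 law) (rmul12 law) (rmul21 law) (rmul22 law); ring.
Qed.

(* An element x with x, x^2 independent generates the even part, which is then commutative. *)
Lemma sqdet_comm x1 x2 : sqdet x1 x2 != 0 -> b1 = c1 /\ b2 = c2.
Proof.
move=> D.
(* The commutator of x and x^2 is [sqdet] times that of e1 and e2, and it vanishes by
   associativity. *)
have E1 : sqdet x1 x2 * (b1 - c1) = 0.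
  transitivity (mul1 x1 x2 (mul1 x1 x2 x1 x2) (mul2 x1 x2 x1 x2) -
                mul1 (mul1 x1 x2 x1 x2) (mul2 x1 x2 x1 x2) x1 x2).
    by rewrite /sqdet; move: (mul1 x1 x2 x1 x2) (mul2 x1 x2 x1 x2) => u v; rewrite /mul1; ring.
  by rewrite mul1A subrr.
have E2 : sqdet x1 x2 * (b2 - c2) = 0.
  transitivity (mul2 x1 x2 (mul1 x1 x2 x1 x2) (mul2 x1 x2 x1 x2) -
                mul2 (mul1 x1 x2 x1 x2) (mul2 x1 x2 x1 x2) x1 x2).
    by rewrite /sqdet; move: (mul1 x1 x2 x1 x2) (mul2 x1 x2 x1 x2) => u v; rewrite /mul2; ring.
  by rewrite mul2A subrr.
move/eqP: E1; move/eqP: E2; rewrite !mulf_eq0 (negPf D) /= !subr_eq0.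
by move=> /eqP -> /eqP ->.
Qed.

(** If the cubic form [sqdet] vanishes, its values at (1,0), (0,1), (1,1), (1,-1) kill its four
    coefficients, so x^2 = lambda(x) x with lambda = (a1, d2). Associativity then leaves b2 in {0,
    a1} and b1 in {0, d2}, which gives the products lambda(x) y and lambda(y) x. *)
Lemma sqdet0_cases :
  (exists x1 x2, sqdet x1 x2 != 0) \/
  ([/\ a2 = 0, b1 = 0, b2 = a1 & c1 = d2] /\ (c2 = 0 /\ d1 = 0)) \/
  ([/\ a2 = 0, c1 = 0, c2 = a1 & b1 = d2] /\ (b2 = 0 /\ d1 = 0)).
Proof.
have [|H] := classic (exists x1 x2, sqdet x1 x2 != 0); [by left|right].
have {}H x1 x2 : sqdet x1 x2 = 0.
  by apply/eqP; apply: negbNE; apply/negP => n0; apply: H; exists x1, x2.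
have a20 : a2 = 0 by rewrite -(H 1 0) /sqdet /mul1 /mul2; ring.
have d10 : d1 = 0 by apply/eqP; rewrite -oppr_eq0 -(H 0 1) /sqdet /mul1 /mul2; apply/eqP; ring.
have two : (2%:R : C) != 0 by rewrite pnatr_eq0.
have c1E : c1 = d2 - b1.
  apply: (mulfI two); apply/eqP; rewrite -subr_eq0; apply/eqP.
  transitivity (- (sqdet 1 (- 1) + sqdet 1 1)); last by rewrite !H addr0 oppr0.
  by rewrite /sqdet /mul1 /mul2 a20 d10; ring.
have c2E : c2 = a1 - b2.
  apply: (mulfI two); apply/eqP; rewrite -subr_eq0; apply/eqP.
  transitivity (sqdet 1 1 - sqdet 1 (- 1)); last by rewrite !H subrr.
  by rewrite /sqdet /mul1 /mul2 a20 d10; ring.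
have b2b1 : b2 * b1 = 0.
  by have := ass1121 law; rewrite a20 mul0r addr0 [b1 * a1]mulrC => /eqP; rewrite addrC -subr_eq subrr eq_sym => /eqP.
have c2c1 : c2 * c1 = 0.
  by have := ass2111 law; rewrite a20 mul0r addr0 [a1 * c1]mulrC => /eqP; rewrite addrC eq_sym -subr_eq subrr eq_sym => /eqP.
have b2b2 : b2 * b2 = b2 * a1.
  by have := ass1122 law; rewrite a20 !mul0r mulr0 addr0 add0r => <-; rewrite mulrC.
have b1b1 : b1 * b1 = b1 * d2.
  by have := ass1221 law; rewrite d10 !mul0r mulr0 addr0 add0r => ->; rewrite mulrC.
have [b20|b20] := eqVneq b2 0; last first.
  have b10 : b1 = 0 by move/eqP: b2b1; rewrite mulf_eq0 (negPf b20) => /eqP.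
  have b2a : b2 = a1 := mulfI b20 b2b2.
  by left; rewrite c1E c2E b10 b2a subr0 subrr.
have c2a : c2 = a1 by rewrite c2E b20 subr0.
have [b10|b10] := eqVneq b1 0; last first.
  have b1d : b1 = d2 := mulfI b10 b1b1.
  by right; rewrite c1E b1d subrr.
have c1d : c1 = d2 by rewrite c1E b10 subr0.
move/eqP: c2c1; rewrite mulf_eq0 => /orP[] /eqP c0.
  by left; rewrite b20 -c2a c0.
by right; rewrite c0 b10 -c1d c0.
Qed.

Definition cub1 x1 x2 := mul1 x1 x2 (mul1 x1 x2 x1 x2) (mul2 x1 x2 x1 x2).
Definition cub2 x1 x2 := mul2 x1 x2 (mul1 x1 x2 x1 x2) (mul2 x1 x2 x1 x2).

(* Cramer's rule for x^3 = a x^2 + b x: a = cubA / sqdet, b = cubB / sqdet. *)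
Definition cubA x1 x2 := x1 * cub2 x1 x2 - x2 * cub1 x1 x2.
Definition cubB x1 x2 := cub1 x1 x2 * mul2 x1 x2 x1 x2 - cub2 x1 x2 * mul1 x1 x2 x1 x2.

(** In the basis x, x^2 everything follows from the cubic relation: x^2 x = x x^2, x^2 x^2 = a x^3 +
    b x^2, L(x^2) = l^2, R(x^2) = r^2. The numbers u, v are the coordinates of s by Cramer's
    rule. *)
Lemma normal_form x1 x2 (D := sqdet x1 x2) (a := cubA x1 x2 / D) (b := cubB x1 x2 / D)
    (l := x1 * l1 + x2 * l2) (r := x1 * r1 + x2 * r2)
    (u := (s1 * mul2 x1 x2 x1 x2 - s2 * mul1 x1 x2 x1 x2) / D)
    (v := (x1 * s2 - x2 * s1) / D) : D != 0 ->
  str_orbit (S14 0 1 b a b a (a * b) (a ^+ 2 + b) l (l ^+ 2) r (r ^+ 2) u v)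
            (S14 a1 a2 b1 b2 c1 c2 d1 d2 l1 l2 r1 r2 s1 s2).
Proof.
move=> D0.
set y1 := mul1 x1 x2 x1 x2; set y2 := mul2 x1 x2 x1 x2.
have DE : x1 * y2 - x2 * y1 = D by [].
have aD : D * a = cubA x1 x2 by rewrite /a mulrC divfK.
have bD : D * b = cubB x1 x2 by rewrite /b mulrC divfK.
have z1 : mul1 x1 x2 y1 y2 = b * x1 + a * y1.
  apply: (mulfI D0); transitivity (D * b * x1 + D * a * y1); last by ring.
  by rewrite aD bD; move: DE => <-; rewrite /cubA /cubB /cub1 /cub2 -/y1 -/y2; ring.
have z2 : mul2 x1 x2 y1 y2 = b * x2 + a * y2.
  apply: (mulfI D0); transitivity (D * b * x2 + D * a * y2); last by ring.
  by rewrite aD bD; move: DE => <-; rewrite /cubA /cubB /cub1 /cub2 -/y1 -/y2; ring.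
have lin1 p q t w c d : mul1 p q (c * t + d * y1) (c * w + d * y2) =
    c * mul1 p q t w + d * mul1 p q y1 y2 by rewrite /mul1; ring.
have lin2 p q t w c d : mul2 p q (c * t + d * y1) (c * w + d * y2) =
    c * mul2 p q t w + d * mul2 p q y1 y2 by rewrite /mul2; ring.
apply: (@S14_orbit x1 x2 y1 y2 1).
- by rewrite DE.
- exact: oner_neq0.
- by rewrite mul0r mul1r add0r.
- by rewrite mul0r mul1r add0r.
- exact: z1.
- exact: z2.
- by rewrite -[LHS]/(mul1 y1 y2 x1 x2) mul1A z1.
- by rewrite -[LHS]/(mul2 y1 y2 x1 x2) mul2A z2.
- by rewrite -[LHS]/(mul1 y1 y2 y1 y2) {1}/y1 {1}/y2 mul1A z1 z2 lin1 -/y1 z1; ring.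
- by rewrite -[LHS]/(mul2 y1 y2 y1 y2) {1}/y1 {1}/y2 mul2A z1 z2 lin2 -/y2 z2; ring.
- by [].
- by rewrite lmul_mul.
- by [].
- by rewrite rmul_mul.
- by rewrite /u /v -/y1 -/y2; apply: (mulfI D0); rewrite -{1}DE; field.
- by rewrite /u /v -/y1 -/y2; apply: (mulfI D0); rewrite -{1}DE; field.
Qed.
End EvenPart.

(** * Commutative even part *)

Lemma quadratic_roots (a b : C) : exists rho rho', a = rho + rho' /\ b = - (rho * rho').
Proof.
pose d := sqrtC (a ^+ 2 + 4%:R * b).
have dE : d ^+ 2 = a ^+ 2 + 4%:R * b by rewrite sqrtCK.
exists ((a + d) / 2%:R), ((a - d) / 2%:R).
have n2 : (2%:R : C) != 0 by rewrite pnatr_eq0.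
split; first by field.
transitivity (- ((a ^+ 2 - d ^+ 2) / 4%:R)); last by field.
by rewrite dE; field.
Qed.

(** Since l and r lie in {0, rho, rho'}, exchanging the roots leaves five patterns. In the second
    one s = v x (x - rho'), a multiple of the idempotent at rho; v = 0 is allowed. *)
Variant Fc_kind : C -> C -> C -> C -> C -> C -> Prop :=
| Fc_kind01 rho rho' : Fc_kind rho rho' 0 0 0 0
| Fc_kind03 rho rho' v : Fc_kind rho rho' rho rho (- (rho' * v)) v
| Fc_kind04 rho rho' : Fc_kind rho rho' 0 rho 0 0
| Fc_kind05 rho rho' : Fc_kind rho rho' rho 0 0 0
| Fc_kind07 rho rho' : Fc_kind rho rho' rho' rho 0 0.

Lemma normal_form_kind a b l r u v :
  S14_law 0 1 b a b a (a * b) (a ^+ 2 + b) l (l ^+ 2) r (r ^+ 2) u v ->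
  exists rho rho', [/\ a = rho + rho', b = - (rho * rho') & Fc_kind rho rho' l r u v].
Proof.
move=> law; have [rho [rho' [aE bE]]] := quadratic_roots a b.
have fac z : b * z + a * z ^+ 2 = z * z ^+ 2 -> [\/ z = 0, z = rho | z = rho'].
  rewrite aE bE => H.
  have : z * ((z - rho) * (z - rho')) = 0.
    transitivity (z * z ^+ 2 - (- (rho * rho') * z + (rho + rho') * z ^+ 2)); first by ring.
    by rewrite H subrr.
  move/eqP; rewrite !mulf_eq0 !subr_eq0 => /orP[/eqP->|/orP[/eqP->|/eqP->]];
  by [constructor 1|constructor 2|constructor 3].
have Hl := fac _ (lmul12 law); have Hr := fac _ (rmul12 law).
have e1 := ls11 law; have e2 := ls12 law; have e3 := rs11 law; have e4 := rs12 law.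
have [v0|v0] := eqVneq v 0.
  have u0 : u = 0 by rewrite v0 mul0r mulr1 addr0 mulr0 in e2.
  rewrite u0 v0.
  case: Hl => ->; case: Hr => ->.
  - by exists rho, rho'; split=> //; constructor.
  - by exists rho, rho'; split=> //; constructor.
  - by exists rho', rho; split; [rewrite addrC|rewrite mulrC|constructor].
  - by exists rho, rho'; split=> //; constructor.
  - exists rho, rho'; split=> //.
    by have := Fc_kind03 rho rho' 0; rewrite mulr0 oppr0.
  - by exists rho', rho; split; [rewrite addrC|rewrite mulrC|constructor].
  - by exists rho', rho; split; [rewrite addrC|rewrite mulrC|constructor].
  - by exists rho, rho'; split=> //; constructor.
  - exists rho', rho; split; [by rewrite addrC|by rewrite mulrC|].
    by have := Fc_kind03 rho' rho 0; rewrite mulr0 oppr0.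
(* For v <> 0, comparing x s = r s with s x = l s gives l = r, and both coordinates of s x = l s
   together make l a root of z^2 = a z + b. *)
have lr : l = r by apply: (mulIf v0); rewrite -e2 -e4.
have uE : u = (l - a) * v by rewrite mulrBl -e4; ring.
have bl : b = l * (l - a).
  by apply: (mulIf v0); rewrite -mulrA -uE -e3; ring.
have : (l - rho) * (l - rho') = 0.
  by transitivity (l * (l - a) - b); [rewrite aE bE; ring|rewrite -bl subrr].
move/eqP; rewrite mulf_eq0 !subr_eq0 => /orP[] /eqP lE.
  exists rho, rho'; split=> //; rewrite -lr lE uE.
  have -> : (l - a) * v = - (rho' * v) by rewrite lE aE; ring.
  exact: Fc_kind03.
exists rho', rho; split; [by rewrite addrC|by rewrite mulrC|rewrite -lr lE uE].
have -> : (l - a) * v = - (rho * v) by rewrite lE aE; ring.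
exact: Fc_kind03.
Qed.

Section Commutative.
Variables (rho rho' : C).
Hypotheses (n0 : rho != 0) (n1 : rho' != 0) (n2 : rho != rho').

Let n3 : rho - rho' != 0. Proof. by rewrite subr_eq0. Qed.
Let n4 : rho' - rho != 0. Proof. by rewrite subr_eq0 eq_sym. Qed.

Lemma Fc_orbit01 : str_orbit (Rtable 0) (Fc rho rho' 0 0 0 0).
Proof. by apply: (@Fc_orbit _ _ _ _ _ _ 1) => //; rewrite ?oner_neq0 //; ring. Qed.

Lemma Fc_orbit03 v : v != 0 -> str_orbit (Rtable 1) (Fc rho rho' rho rho (- (rho' * v)) v).
Proof.
(* Here s = rho (rho - rho') v E1, and h makes the square of h f1 equal to E1. *)
move=> v0; pose h : C := sqrtC ((rho * (rho - rho') * v)^-1).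
have hE : h ^+ 2 = (rho * (rho - rho') * v)^-1 by rewrite sqrtCK.
have h0 : h != 0 by rewrite sqrtC_eq0 invr_eq0 !mulf_neq0.
by apply: (@Fc_orbit _ _ _ _ _ _ h) => //; rewrite ?hE; [ring..|field|field]; rewrite ?n0 ?n1 ?n3 ?n4 ?v0.
Qed.

Lemma Fc_orbit04 : str_orbit (Rtable 2) (Fc rho rho' 0 rho 0 0).
Proof. by apply: (@Fc_orbit _ _ _ _ _ _ 1) => //; rewrite ?oner_neq0 //; ring. Qed.

Lemma Fc_orbit05 : str_orbit (Rtable 3) (Fc rho rho' rho 0 0 0).
Proof. by apply: (@Fc_orbit _ _ _ _ _ _ 1) => //; rewrite ?oner_neq0 //; ring. Qed.

Lemma Fc_orbit07 : str_orbit (Rtable 4) (Fc rho rho' rho' rho 0 0).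
Proof. by apply: (@Fc_orbit _ _ _ _ _ _ 1) => //; rewrite ?oner_neq0 //; ring. Qed.
End Commutative.

(** Parameters with distinct nonzero roots, and v <> 0 for R03, give the listed algebra itself; all
    others are reached along a line of parameters. *)
Lemma Fc_zclosure rho rho' l r u v : Fc_kind rho rho' l r u v ->
  exists k : 'I_13, zclosure (str_orbit (Rtable k)) (Fc rho rho' l r u v).
Proof.
pose x i (y : 'I_3 -> C) := y (inord i).
pose pt (y : seq C) : 'I_3 -> C := fun i => nth 0 y i.
pose D y := x 0%N y * x 1%N y * (x 0%N y - x 1%N y) * x 2%N y.
have Dn0 : exists y, D y != 0.
  exists (pt [:: 1; 2%:R; 1]); rewrite /D /x /pt !inordK //=.
  have -> : 1 * 2%:R * (1 - 2%:R) * 1 = - 2%:R :> C by ring.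
  by rewrite oppr_eq0 pnatr_eq0.
have DP y : D y != 0 -> [/\ x 0%N y != 0, x 1%N y != 0, x 0%N y != x 1%N y & x 2%N y != 0].
  by rewrite /D !mulf_eq0 !negb_or subr_eq0 => /andP[/andP[/andP[-> ->] ->] ->].
have px i : polyfun (x i) by exact: polyfun_var.
have pD : polyfun D by rewrite /D; polyfun_tac.
have ptE y0 y1 y2 : (x 0%N (pt [:: y0; y1; y2]) = y0) * (x 1%N (pt [:: y0; y1; y2]) = y1) *
   (x 2%N (pt [:: y0; y1; y2]) = y2) by rewrite /x /pt !inordK.
have K (k : 'I_13) (fl fr fu fv : ('I_3 -> C) -> C) (y : 'I_3 -> C) :
    polyfun fl -> polyfun fr -> polyfun fu -> polyfun fv ->
    (forall y, D y != 0 -> str_orbit (Rtable k) (Fc (x 0%N y) (x 1%N y) (fl y) (fr y) (fu y) (fv y))) ->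
    zclosure (str_orbit (Rtable k)) (Fc (x 0%N y) (x 1%N y) (fl y) (fr y) (fu y) (fv y)).
  move=> pl pr pu pv H.
  apply: (@zclosure_line _ (fun y => Fc (x 0%N y) (x 1%N y) (fl y) (fr y) (fu y) (fv y)) D) => // t.
  by apply: polyfun_S14; polyfun_tac.
have c0 := @polyfun_const 3 0.
case=> {rho rho' l r u v} rho rho'.
- exists (inord 0); have := K (inord 0) _ _ _ _ (pt [:: rho; rho'; 0]) c0 c0 c0 c0.
  rewrite !ptE inordK //; apply=> y /DP[? ? ? _]; exact: Fc_orbit01.
- move=> v; exists (inord 1).
  have p1 : polyfun (fun y => - (x 1%N y * x 2%N y)) by polyfun_tac.
  have := K (inord 1) _ _ _ _ (pt [:: rho; rho'; v]) (px 0%N) (px 0%N) p1 (px 2%N).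
  rewrite !ptE inordK //; apply=> y /DP[? ? ? ?]; exact: Fc_orbit03.
- exists (inord 2); have := K (inord 2) _ _ _ _ (pt [:: rho; rho'; 0]) c0 (px 0%N) c0 c0.
  rewrite !ptE inordK //; apply=> y /DP[? ? ? _]; exact: Fc_orbit04.
- exists (inord 3); have := K (inord 3) _ _ _ _ (pt [:: rho; rho'; 0]) (px 0%N) c0 c0 c0.
  rewrite !ptE inordK //; apply=> y /DP[? ? ? _]; exact: Fc_orbit05.
- exists (inord 4); have := K (inord 4) _ _ _ _ (pt [:: rho; rho'; 0]) (px 1%N) (px 0%N) c0 c0.
  rewrite !ptE inordK //; apply=> y /DP[? ? ? _]; exact: Fc_orbit07.
Qed.

Lemma commutative_zclosure a1 a2 b1 b2 c1 c2 d1 d2 l1 l2 r1 r2 s1 s2 x1 x2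
    (mu := S14 a1 a2 b1 b2 c1 c2 d1 d2 l1 l2 r1 r2 s1 s2) :
  BAvar mu -> sqdet a1 a2 b1 b2 c1 c2 d1 d2 x1 x2 != 0 ->
  exists k : 'I_13, zclosure (str_orbit (Rtable k)) mu.
Proof.
move=> X D; have O := normal_form (BAvar_S14_law X) D.
have [rho [rho' [aE bE kind]]] := normal_form_kind (BAvar_S14_law (BAvar_orbit X (orbit_sym O))).
have [k Hk] := Fc_zclosure kind; exists k; apply: (zclosure_orbit _ O).
by rewrite aE bE.
Qed.

(** * Even part xy = lambda(x) y or xy = lambda(y) x *)

Ltac law_tac h :=
  match type of h with ?u = _ => transitivity u; [ring | rewrite h; ring] end.

(** Here lambda = (a, d), and x, y stand for L, R when the product is lambda(x) y, for R, L when it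
    is lambda(y) x. A nonzero functional z with lambda(e_i) z(e_j) = z(e_i) z(e_j) is lambda. The
    last four equations read lambda(s) e_i = x_i s; for s <> 0, an e_i not proportional to s gives
    lambda(s) = 0, and then x = 0. *)
Lemma character_cases (a d x1 x2 y1 y2 s1 s2 : C) :
  a * x1 = x1 * x1 -> a * x2 = x1 * x2 -> d * x1 = x1 * x2 -> d * x2 = x2 * x2 ->
  a * y1 = y1 * y1 -> a * y2 = y1 * y2 -> d * y1 = y1 * y2 -> d * y2 = y2 * y2 ->
  a * s1 = y1 * s1 -> a * s2 = y1 * s2 -> d * s1 = y2 * s1 -> d * s2 = y2 * s2 ->
  a * s1 + d * s2 = x1 * s1 -> 0 = x1 * s2 -> 0 = x2 * s1 -> a * s1 + d * s2 = x2 * s2 ->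
  ((x1 = 0 /\ x2 = 0) \/ (x1 = a /\ x2 = d)) /\
  ((y1 = 0 /\ y2 = 0) \/ (y1 = a /\ y2 = d)) /\
  ((s1 = 0 /\ s2 = 0) \/ [/\ x1 = 0, x2 = 0, y1 = a, y2 = d & a * s1 + d * s2 = 0]).
Proof.
have char z1 z2 : a * z1 = z1 * z1 -> a * z2 = z1 * z2 -> d * z1 = z1 * z2 ->
    d * z2 = z2 * z2 -> (z1 = 0 /\ z2 = 0) \/ (z1 = a /\ z2 = d).
  move=> e1 e2 e3 e4; have [z10|z10] := eqVneq z1 0; last first.
    by right; split; apply: (mulIf z10); rewrite ?e1 ?e3 // mulrC.
  have [z20|z20] := eqVneq z2 0; first by left.
  by right; split; apply: (mulIf z20); rewrite ?e2 ?e4.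
move=> X1 X2 X3 X4 Y1 Y2 Y3 Y4 S1 S2 S3 S4 T1 T2 T3 T4.
split; first exact: char; split; first exact: char.
have [s10|s10] := eqVneq s1 0; have [s20|s20] := eqVneq s2 0; first by left.
- right; have x10 : x1 = 0 by apply: (mulIf s20); rewrite -T2 mul0r.
  have E : a * s1 + d * s2 = 0 by rewrite T1 x10 mul0r.
  split=> //; apply: (mulIf s20); first by rewrite -T4 E mul0r.
  + by rewrite S2.
  + by rewrite S4.
- right; have x20 : x2 = 0 by apply: (mulIf s10); rewrite -T3 mul0r.
  have E : a * s1 + d * s2 = 0 by rewrite T4 x20 mul0r.
  split=> //; apply: (mulIf s10); first by rewrite -T1 E mul0r.
  + by rewrite S1.
  + by rewrite S3.
- right; have x20 : x2 = 0 by apply: (mulIf s10); rewrite -T3 mul0r.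
  have E : a * s1 + d * s2 = 0 by rewrite T4 x20 mul0r.
  split=> //; apply: (mulIf s10); first by rewrite -T1 E mul0r.
  + by rewrite S1.
  + by rewrite S3.
Qed.

(** Even product x y = lambda(x) y with lambda = (a, d). *)
Definition left_str a d l1 l2 r1 r2 s1 s2 : Str := S14 a 0 0 a d 0 0 d l1 l2 r1 r2 s1 s2.

(** The new basis is e1 / a, where lambda is 1, and - d e1 + a e2, which spans the kernel of
    lambda. *)
Lemma left_orbit a d eL eR : a != 0 ->
  str_orbit (S14 1 0 0 1 0 0 0 0 eL 0 eR 0 0 0)
            (left_str a d (eL * a) (eL * d) (eR * a) (eR * d) 0 0).
Proof.
move=> a0; apply: (@S14_orbit a^-1 0 (- d) a 1); rewrite ?oner_neq0 //; try by field.
by rewrite mul0r subr0 mulVf ?oner_neq0.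
Qed.

Lemma left_orbit_s a d s1 s2 : a != 0 -> s2 != 0 -> a * s1 + d * s2 = 0 ->
  str_orbit (S14 1 0 0 1 0 0 0 0 0 0 1 0 0 1)
            (left_str a d 0 0 a d s1 s2).
Proof.
move=> a0 s0 E.
have s1E : s1 = - d * s2 / a.
  by apply: (mulfI a0); rewrite -[LHS](addrK (d * s2)) E; field.
(* Since lambda(s) = 0 and s <> 0, the vector s itself spans the kernel of lambda and serves as
   second basis vector. *)
apply: (@S14_orbit a^-1 0 s1 s2 1); rewrite ?oner_neq0 ?s1E //; try by field.
by rewrite mul0r subr0 mulf_neq0 ?invr_eq0.
Qed.

Lemma left_zclosure a d eL eR :
  zclosure (str_orbit (S14 1 0 0 1 0 0 0 0 eL 0 eR 0 0 0))
           (left_str a d (eL * a) (eL * d) (eR * a) (eR * d) 0 0).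
Proof.
pose x i (y : 'I_2 -> C) := y (inord i).
have := @zclosure_line 2 (fun y => left_str (x 0%N y) (x 1%N y) (eL * x 0%N y) (eL * x 1%N y)
  (eR * x 0%N y) (eR * x 1%N y) 0 0) (x 0%N) _ _ _ _ _ (fun i => nth 0 [:: a; d] i).
rewrite /x !inordK //=; apply.
- by move=> t; apply: polyfun_S14; polyfun_tac.
- exact: polyfun_var.
- by move=> y; apply: left_orbit.
- by exists (fun=> 1); rewrite oner_neq0.
Qed.

(** The equation lambda(s) = 0 cuts out a cone, which needs a polynomial parametrisation before
    [zclosure_line] applies: (d, -a) and s are proportional, hence equal to u (p, q) and v (p,
    q). *)
Lemma left_zclosure_s a d s1 s2 : a * s1 + d * s2 = 0 ->
  zclosure (str_orbit (S14 1 0 0 1 0 0 0 0 0 0 1 0 0 1))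
           (left_str a d 0 0 a d s1 s2).
Proof.
move=> E; have [u [v [p [q [aE dE s1E s2E]]]]] : exists u v p q,
    [/\ a = - (u * q), d = u * p, s1 = v * p & s2 = v * q].
  have [s0|s0] := eqVneq s1 0; have [s0'|s0'] := eqVneq s2 0.
  - by exists 1, 0, d, (- a); split; rewrite ?s0 ?s0'; ring.
  - exists (- a / s2), 1, s1, s2; split; [by field| |by ring..].
    by apply: (mulIf s0'); rewrite -[LHS](addKr (a * s1)) E s0; ring.
  - exists (d / s1), 1, s1, s2; split; [|by field|by ring..].
    by apply: (mulIf s0); rewrite -[LHS](addrK (d * s2)) E s0'; ring.
  - exists (d / s1), 1, s1, s2; split; [|by field|by ring..].
    by apply: (mulIf s0); rewrite -[LHS](addrK (d * s2)) E; field.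
rewrite aE dE s1E s2E.
pose x i (y : 'I_4 -> C) := y (inord i).
pose fa y := - (x 0%N y * x 3%N y); pose fd y := x 0%N y * x 2%N y.
have := @zclosure_line 4 (fun y => left_str (fa y) (fd y) 0 0 (fa y) (fd y)
  (x 1%N y * x 2%N y) (x 1%N y * x 3%N y)) (fun y => x 0%N y * x 1%N y * x 3%N y)
  _ _ _ _ _ (fun i => nth 0 [:: u; v; p; q] i).
rewrite /fa /fd /x !inordK //=; apply.
- by move=> t; apply: polyfun_S14; polyfun_tac.
- by polyfun_tac.
- move=> y; rewrite !mulf_eq0 !negb_or => /andP[/andP[u0 v0] q0].
  by apply: left_orbit_s; rewrite ?oppr_eq0 ?mulf_neq0 //; ring.
- by exists (fun=> 1); rewrite !mulr1 oner_neq0.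
Qed.

Lemma left_cases a d l1 l2 r1 r2 s1 s2 :
  S14_law a 0 0 a d 0 0 d l1 l2 r1 r2 s1 s2 ->
  ((l1 = 0 /\ l2 = 0) \/ (l1 = a /\ l2 = d)) /\
  ((r1 = 0 /\ r2 = 0) \/ (r1 = a /\ r2 = d)) /\
  ((s1 = 0 /\ s2 = 0) \/ [/\ l1 = 0, l2 = 0, r1 = a, r2 = d & a * s1 + d * s2 = 0]).
Proof.
move=> law.
have [||||||||||||||||cX [cY cS]] := @character_cases a d l1 l2 r1 r2 s1 s2.
- law_tac (lmul11 law).
- law_tac (lmul12 law).
- law_tac (lmul21 law).
- law_tac (lmul22 law).
- law_tac (rmul11 law).
- law_tac (rmul12 law).
- law_tac (rmul21 law).
- law_tac (rmul22 law).
- law_tac (ls11 law).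
- law_tac (ls12 law).
- law_tac (ls21 law).
- law_tac (ls22 law).
- law_tac (rs11 law).
- law_tac (rs12 law).
- law_tac (rs21 law).
- law_tac (rs22 law).
by [].
Qed.

(** Opposite even product, x y = lambda(y) x; L and R exchange their roles. *)
Definition right_str a d l1 l2 r1 r2 s1 s2 : Str := S14 a 0 d 0 0 a 0 d l1 l2 r1 r2 s1 s2.

Lemma right_orbit a d eL eR : a != 0 ->
  str_orbit (S14 1 0 0 0 0 1 0 0 eL 0 eR 0 0 0)
            (right_str a d (eL * a) (eL * d) (eR * a) (eR * d) 0 0).
Proof.
move=> a0; apply: (@S14_orbit a^-1 0 (- d) a 1); rewrite ?oner_neq0 //; try by field.
by rewrite mul0r subr0 mulVf ?oner_neq0.
Qed.

Lemma right_orbit_s a d s1 s2 : a != 0 -> s2 != 0 -> a * s1 + d * s2 = 0 ->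
  str_orbit (S14 1 0 0 0 0 1 0 0 1 0 0 0 0 1)
            (right_str a d a d 0 0 s1 s2).
Proof.
move=> a0 s0 E.
have s1E : s1 = - d * s2 / a.
  by apply: (mulfI a0); rewrite -[LHS](addrK (d * s2)) E; field.
apply: (@S14_orbit a^-1 0 s1 s2 1); rewrite ?oner_neq0 ?s1E //; try by field.
by rewrite mul0r subr0 mulf_neq0 ?invr_eq0.
Qed.

Lemma right_zclosure a d eL eR :
  zclosure (str_orbit (S14 1 0 0 0 0 1 0 0 eL 0 eR 0 0 0))
           (right_str a d (eL * a) (eL * d) (eR * a) (eR * d) 0 0).
Proof.
pose x i (y : 'I_2 -> C) := y (inord i).
have := @zclosure_line 2 (fun y => right_str (x 0%N y) (x 1%N y) (eL * x 0%N y) (eL * x 1%N y)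
  (eR * x 0%N y) (eR * x 1%N y) 0 0) (x 0%N) _ _ _ _ _ (fun i => nth 0 [:: a; d] i).
rewrite /x !inordK //=; apply.
- by move=> t; apply: polyfun_S14; polyfun_tac.
- exact: polyfun_var.
- by move=> y; apply: right_orbit.
- by exists (fun=> 1); rewrite oner_neq0.
Qed.

Lemma right_zclosure_s a d s1 s2 : a * s1 + d * s2 = 0 ->
  zclosure (str_orbit (S14 1 0 0 0 0 1 0 0 1 0 0 0 0 1))
           (right_str a d a d 0 0 s1 s2).
Proof.
move=> E; have [u [v [p [q [aE dE s1E s2E]]]]] : exists u v p q,
    [/\ a = - (u * q), d = u * p, s1 = v * p & s2 = v * q].
  have [s0|s0] := eqVneq s1 0; have [s0'|s0'] := eqVneq s2 0.
  - by exists 1, 0, d, (- a); split; rewrite ?s0 ?s0'; ring.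
  - exists (- a / s2), 1, s1, s2; split; [by field| |by ring..].
    by apply: (mulIf s0'); rewrite -[LHS](addKr (a * s1)) E s0; ring.
  - exists (d / s1), 1, s1, s2; split; [|by field|by ring..].
    by apply: (mulIf s0); rewrite -[LHS](addrK (d * s2)) E s0'; ring.
  - exists (d / s1), 1, s1, s2; split; [|by field|by ring..].
    by apply: (mulIf s0); rewrite -[LHS](addrK (d * s2)) E; field.
rewrite aE dE s1E s2E.
pose x i (y : 'I_4 -> C) := y (inord i).
pose fa y := - (x 0%N y * x 3%N y); pose fd y := x 0%N y * x 2%N y.
have := @zclosure_line 4 (fun y => right_str (fa y) (fd y) (fa y) (fd y) 0 0
  (x 1%N y * x 2%N y) (x 1%N y * x 3%N y)) (fun y => x 0%N y * x 1%N y * x 3%N y)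
  _ _ _ _ _ (fun i => nth 0 [:: u; v; p; q] i).
rewrite /fa /fd /x !inordK //=; apply.
- by move=> t; apply: polyfun_S14; polyfun_tac.
- by polyfun_tac.
- move=> y; rewrite !mulf_eq0 !negb_or => /andP[/andP[u0 v0] q0].
  by apply: right_orbit_s; rewrite ?oppr_eq0 ?mulf_neq0 //; ring.
- by exists (fun=> 1); rewrite !mulr1 oner_neq0.
Qed.

Lemma right_cases a d l1 l2 r1 r2 s1 s2 :
  S14_law a 0 d 0 0 a 0 d l1 l2 r1 r2 s1 s2 ->
  ((l1 = 0 /\ l2 = 0) \/ (l1 = a /\ l2 = d)) /\
  ((r1 = 0 /\ r2 = 0) \/ (r1 = a /\ r2 = d)) /\
  ((s1 = 0 /\ s2 = 0) \/ [/\ r1 = 0, r2 = 0, l1 = a, l2 = d & a * s1 + d * s2 = 0]).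
Proof.
move=> law.
have [||||||||||||||||cX [cY cS]] := @character_cases a d r1 r2 l1 l2 s1 s2.
- law_tac (rmul11 law).
- law_tac (rmul21 law).
- law_tac (rmul12 law).
- law_tac (rmul22 law).
- law_tac (lmul11 law).
- law_tac (lmul21 law).
- law_tac (lmul12 law).
- law_tac (lmul22 law).
- law_tac (rs11 law).
- law_tac (rs12 law).
- law_tac (rs21 law).
- law_tac (rs22 law).
- law_tac (ls11 law).
- law_tac (ls12 law).
- law_tac (ls21 law).
- law_tac (ls22 law).
by [].
Qed.

(** * Covering by the orbit closures *)

Lemma left_cover a d l1 l2 r1 r2 s1 s2 :
  S14_law a 0 0 a d 0 0 d l1 l2 r1 r2 s1 s2 ->
  exists k : 'I_13, zclosure (str_orbit (Rtable k)) (left_str a d l1 l2 r1 r2 s1 s2).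
Proof.
move=> /left_cases[HL [HR HS]].
case: HS => [[-> ->]|[-> -> -> -> E]]; last first.
  by exists (inord 8); rewrite inordK //; apply: left_zclosure_s.
have z eL eR := @left_zclosure a d eL eR.
case: HL => -[-> ->]; case: HR => -[-> ->].
- by exists (inord 5); rewrite inordK //; have := z 0 0; rewrite !mul0r.
(* L = 0, R = lambda, s = 0 is the degenerate member of the family of R30. *)
- exists (inord 8); rewrite inordK //; apply: left_zclosure_s; ring.
- by exists (inord 10); rewrite inordK //; have := z 1 0; rewrite !mul0r !mul1r.
- by exists (inord 12); rewrite inordK //; have := z 1 1; rewrite !mul1r.
Qed.

Lemma right_cover a d l1 l2 r1 r2 s1 s2 :
  S14_law a 0 d 0 0 a 0 d l1 l2 r1 r2 s1 s2 ->
  exists k : 'I_13, zclosure (str_orbit (Rtable k)) (right_str a d l1 l2 r1 r2 s1 s2).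
Proof.
move=> /right_cases[HL [HR HS]].
case: HS => [[-> ->]|[-> -> -> -> E]]; last first.
  by exists (inord 7); rewrite inordK //; apply: right_zclosure_s.
have z eL eR := @right_zclosure a d eL eR.
case: HL => -[-> ->]; case: HR => -[-> ->].
- by exists (inord 6); rewrite inordK //; have := z 0 0; rewrite !mul0r.
- by exists (inord 9); rewrite inordK //; have := z 0 1; rewrite !mul0r !mul1r.
(* L = lambda, R = 0, s = 0 is the degenerate member of the family of R28. *)
- exists (inord 7); rewrite inordK //; apply: right_zclosure_s; ring.
- by exists (inord 11); rewrite inordK //; have := z 1 1; rewrite !mul1r.
Qed.

Lemma BAvar_cover mu : BAvar mu -> exists k : 'I_13, zclosure (str_orbit (Ralg k)) mu.
Proof.
move=> X; suff [k Hk] : exists k : 'I_13, zclosure (str_orbit (Rtable k)) mu.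
  by exists k; rewrite RalgE.
have [ev _] := X; move: X; rewrite (even_S14 ev).
move: (sc mu o0 o0 o0) (sc mu o0 o0 o1) (sc mu o0 o1 o0) (sc mu o0 o1 o1)
      (sc mu o1 o0 o0) (sc mu o1 o0 o1) (sc mu o1 o1 o0) (sc mu o1 o1 o1)
      (sc mu o0 o2 o2) (sc mu o1 o2 o2) (sc mu o2 o0 o2) (sc mu o2 o1 o2)
      (sc mu o2 o2 o0) (sc mu o2 o2 o1) => {mu ev}.
move=> a1 a2 b1 b2 c1 c2 d1 d2 l1 l2 r1 r2 s1 s2 X.
have law := BAvar_S14_law X.
case: (sqdet0_cases law) => [[x1 [x2 D]]|[] [[e1 e2 e3 e4] [e5 e6]]].
- exact: commutative_zclosure D.
- by move: law; rewrite e1 e2 e3 e4 e5 e6; apply: left_cover.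
- by move: law; rewrite e1 e2 e3 e4 e5 e6; apply: right_cover.
Qed.

(* Entry k is nonzero at [Ralg k] and vanishes on the rest of the variety.  In
   the first five, x = e1 + 2 e2 generates the even part with distinct nonzero
   eigenvalues, the roots of D z^2 - A z - B; l = L(x) and r = R(x). *)
Definition test14 (k : nat) (a1 a2 b1 b2 c1 c2 d1 d2 l1 l2 r1 r2 s1 s2 : C) : C :=
  let D := sqdet a1 a2 b1 b2 c1 c2 d1 d2 1 2%:R in
  let A := cubA a1 a2 b1 b2 c1 c2 d1 d2 1 2%:R in
  let B := cubB a1 a2 b1 b2 c1 c2 d1 d2 1 2%:R in
  let l := 1 * l1 + 2%:R * l2 in let r := 1 * r1 + 2%:R * r2 in
  let com := D * B * (A ^+ 2 + 4%:R * D * B) in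
  let nl := D * l ^+ 2 - A * l - B in let nr := D * r ^+ 2 - A * r - B in
  let lf := b2 * (b2 - c2) in let rt := c2 * (c2 - b2) in
  nth 0 [:: com * (nl * nr); com * s1; com * (nl * r); com * (l * nr); com * (l * r * (l - r));
            lf * ((l1 - b2) * (r1 - b2)); rt * ((l1 - c2) * (r1 - c2)); rt * s2; lf * s2;
            rt * ((l1 - c2) * r1); lf * (l1 * (r1 - b2)); rt * (l1 * r1); lf * (l1 * r1)] k.

Definition open_test (k : nat) (mu : Str) : C :=
  test14 k (sc mu o0 o0 o0) (sc mu o0 o0 o1) (sc mu o0 o1 o0) (sc mu o0 o1 o1)
    (sc mu o1 o0 o0) (sc mu o1 o0 o1) (sc mu o1 o1 o0) (sc mu o1 o1 o1)
    (sc mu o0 o2 o2) (sc mu o1 o2 o2) (sc mu o2 o0 o2) (sc mu o2 o1 o2)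
    (sc mu o2 o2 o0) (sc mu o2 o2 o1).

Lemma polyfun_open_test k : polyfun (open_test k).
Proof.
rewrite /open_test /test14 /cubA /cubB /cub1 /cub2 /sqdet /mul1 /mul2.
by move: k => [|[|[|[|[|[|[|[|[|[|[|[|[|k]]]]]]]]]]]]]; rewrite /= ?nth_nil; polyfun_tac.
Qed.

Lemma open_test_S14 k a1 a2 b1 b2 c1 c2 d1 d2 l1 l2 r1 r2 s1 s2 :
  open_test k (S14 a1 a2 b1 b2 c1 c2 d1 d2 l1 l2 r1 r2 s1 s2) =
  test14 k a1 a2 b1 b2 c1 c2 d1 d2 l1 l2 r1 r2 s1 s2.
Proof. by rewrite /open_test !sc_mkStr. Qed.

Lemma open_test_Ralg (k : 'I_13) : open_test k (Ralg k) != 0.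
Proof.
have E (c v : C) : v != 0 -> c = v -> c != 0 by move=> v0 ->.
have p2 n : - 2%:R ^+ n != 0 :> C by rewrite oppr_eq0 expf_neq0 // pnatr_eq0.
have n1 : - 1 != 0 :> C by rewrite oppr_eq0 oner_eq0.
have p1 := oner_neq0 C.
rewrite RalgE; case: k => [[|[|[|[|[|[|[|[|[|[|[|[|[|]]]]]]]]]]]]] h] //;
  rewrite [Rtable _]/= open_test_S14 /test14 /cubA /cubB /cub1 /cub2 /sqdet /mul1 /mul2; cbn [nth nat_of_ord].
(* In the first five algebras e1 + 2 e2 has D = 2, A = 6, B = -4, with roots 1 and 2, so the common
   factor [com] is - 2^5. *)
- by apply: (E _ (- 2%:R ^+ 9)) => //; ring.
- by apply: (E _ (- 2%:R ^+ 5)) => //; ring.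
- by apply: (E _ (- 2%:R ^+ 7)) => //; ring.
- by apply: (E _ (- 2%:R ^+ 7)) => //; ring.
- by apply: (E _ (- 2%:R ^+ 6)) => //; ring.
- by apply: (E _ 1) => //; ring.
- by apply: (E _ 1) => //; ring.
- by apply: (E _ 1) => //; ring.
- by apply: (E _ 1) => //; ring.
- by apply: (E _ (- 1)) => //; ring.
- by apply: (E _ (- 1)) => //; ring.
- by apply: (E _ 1) => //; ring.
- by apply: (E _ 1) => //; ring.
Qed.

(** Here B = - D rho rho' and A^2 + 4 D B = (D (rho - rho'))^2, so the hypothesis says that the
    roots are nonzero and distinct. The factorisation evaluates the tests on l and r; the last
    clause detects s from its coordinates u, v. *)
Lemma commutative_generic a1 a2 b1 b2 c1 c2 d1 d2 l1 l2 r1 r2 s1 s2 x1 x2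
    (mu := S14 a1 a2 b1 b2 c1 c2 d1 d2 l1 l2 r1 r2 s1 s2)
    (D := sqdet a1 a2 b1 b2 c1 c2 d1 d2 x1 x2) (A := cubA a1 a2 b1 b2 c1 c2 d1 d2 x1 x2)
    (B := cubB a1 a2 b1 b2 c1 c2 d1 d2 x1 x2)
    (l := x1 * l1 + x2 * l2) (r := x1 * r1 + x2 * r2) :
  BAvar mu -> D * B * (A ^+ 2 + 4%:R * D * B) != 0 ->
  exists rho rho' u v,
  [/\ rho != 0, rho' != 0 & rho != rho'] /\
  [/\ Fc_kind rho rho' l r u v, str_orbit (Fc rho rho' l r u v) mu,
      forall z, D * z ^+ 2 - A * z - B = D * (z - rho) * (z - rho') &
      u = 0 -> v = 0 -> s1 = 0].
Proof.
move=> X; rewrite !mulf_eq0 !negb_or => /andP[/andP[D0 B0] disc].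
have O := normal_form (BAvar_S14_law X) D0.
have [rho [rho' [aE bE kind]]] := normal_form_kind (BAvar_S14_law (BAvar_orbit X (orbit_sym O))).
move: O kind aE bE; rewrite -/D -/A -/B -/l -/r; set u := ((s1 * _ - _) / D).
set v := ((_ - x2 * s1) / D) => O kind aE bE.
have AE : A = D * (rho + rho') by rewrite -aE mulrC divfK.
have BE : B = - (D * (rho * rho')) by rewrite -mulrN -bE mulrC divfK.
exists rho, rho', u, v; split; split=> //.
- by apply: contraNneq B0 => e; rewrite BE e mul0r mulr0 oppr0.
- by apply: contraNneq B0 => e; rewrite BE e !mulr0 oppr0.
- by apply: contraNneq disc => e; rewrite AE BE e; apply/eqP; ring.
- by rewrite /Fc -aE -bE.
- by move=> z; rewrite AE BE; ring.
move=> u0 v0.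
apply: (mulIf D0); rewrite mul0r.
transitivity (x1 * (u * D) + mul1 a1 b1 c1 d1 x1 x2 x1 x2 * (v * D)); last first.
  by rewrite u0 v0 !mul0r !mulr0 addr0.
by rewrite /u /v !divfK // /D /sqdet; ring.
Qed.

(** A generator x of the even part would force b2 = c2, and the product lambda(y) x has b2 = 0; only
    lambda(x) y remains. *)
Lemma left_generic a1 a2 b1 b2 c1 c2 d1 d2 l1 l2 r1 r2 s1 s2 :
  S14_law a1 a2 b1 b2 c1 c2 d1 d2 l1 l2 r1 r2 s1 s2 -> b2 * (b2 - c2) != 0 ->
  b2 != 0 /\ S14 a1 a2 b1 b2 c1 c2 d1 d2 l1 l2 r1 r2 s1 s2 = left_str b2 d2 l1 l2 r1 r2 s1 s2.
Proof.
move=> law; rewrite mulf_eq0 negb_or subr_eq0 => /andP[n0 n1]; split=> //.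
case: (sqdet0_cases law) => [[x1 [x2 D]]|[] [[-> e1 e2 e3] [e4 ->]]].
- by have [_ /eqP] := sqdet_comm law D; rewrite (negPf n1).
- by rewrite e1 e2 e3 e4.
- by rewrite e4 eqxx in n0.
Qed.

Lemma right_generic a1 a2 b1 b2 c1 c2 d1 d2 l1 l2 r1 r2 s1 s2 :
  S14_law a1 a2 b1 b2 c1 c2 d1 d2 l1 l2 r1 r2 s1 s2 -> c2 * (c2 - b2) != 0 ->
  c2 != 0 /\ S14 a1 a2 b1 b2 c1 c2 d1 d2 l1 l2 r1 r2 s1 s2 = right_str c2 d2 l1 l2 r1 r2 s1 s2.
Proof.
move=> law; rewrite mulf_eq0 negb_or subr_eq0 => /andP[n0 n1]; split=> //.
case: (sqdet0_cases law) => [[x1 [x2 D]]|[] [[-> e1 e2 e3] [e4 ->]]].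
- by have [_ /eqP] := sqdet_comm law D; rewrite eq_sym (negPf n1).
- by rewrite e4 eqxx in n0.
- by rewrite e1 e2 e3 e4.
Qed.

(** * Openness of the orbits *)

(** The first factor of each test selects the type of even part and makes it generic; the second
    vanishes on every pattern of L, R, s except the k-th. *)
Lemma open_test_orbit (k : 'I_13) mu :
  BAvar mu -> open_test k mu != 0 -> str_orbit (Ralg k) mu.
Proof.
rewrite RalgE => X; have [ev _] := X; move: X; rewrite (even_S14 ev) open_test_S14.
move: (sc mu o0 o0 o0) (sc mu o0 o0 o1) (sc mu o0 o1 o0) (sc mu o0 o1 o1)
      (sc mu o1 o0 o0) (sc mu o1 o0 o1) (sc mu o1 o1 o0) (sc mu o1 o1 o1)
      (sc mu o0 o2 o2) (sc mu o1 o2 o2) (sc mu o2 o0 o2) (sc mu o2 o1 o2)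
      (sc mu o2 o2 o0) (sc mu o2 o2 o1) => {mu ev}.
move=> a1 a2 b1 b2 c1 c2 d1 d2 l1 l2 r1 r2 s1 s2 X.
have law := BAvar_S14_law X; rewrite /test14.
have leftE n : b2 * (b2 - c2) != 0 -> (b2 != 0 -> S14_law b2 0 0 b2 d2 0 0 d2 l1 l2 r1 r2 s1 s2 ->
      str_orbit (Rtable n) (left_str b2 d2 l1 l2 r1 r2 s1 s2)) ->
    str_orbit (Rtable n) (S14 a1 a2 b1 b2 c1 c2 d1 d2 l1 l2 r1 r2 s1 s2).
  move=> t H; have [n0 E] := left_generic law t.
  by rewrite E; apply: H => //; apply: BAvar_S14_law; move: X; rewrite E.
have rightE n : c2 * (c2 - b2) != 0 -> (c2 != 0 -> S14_law c2 0 d2 0 0 c2 0 d2 l1 l2 r1 r2 s1 s2 ->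
      str_orbit (Rtable n) (right_str c2 d2 l1 l2 r1 r2 s1 s2)) ->
    str_orbit (Rtable n) (S14 a1 a2 b1 b2 c1 c2 d1 d2 l1 l2 r1 r2 s1 s2).
  move=> t H; have [n0 E] := right_generic law t.
  by rewrite E; apply: H => //; apply: BAvar_S14_law; move: X; rewrite E.
have comE := commutative_generic (x1 := 1) (x2 := 2%:R) X.
move: (sqdet _ _ _ _ _ _ _ _ _ _) (cubA _ _ _ _ _ _ _ _ _ _) (cubB _ _ _ _ _ _ _ _ _ _) comE => D A B.
move: (1 * l1 + _) (1 * r1 + _) => l r comE.
have root0 (rho rho' : C) : D * (rho - rho) * (rho - rho') = 0 by rewrite subrr mulr0 mul0r.
have root0' (rho rho' : C) : D * (rho' - rho) * (rho' - rho') = 0 by rewrite subrr mulr0.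
case: k => [[|[|[|[|[|[|[|[|[|[|[|[|[|]]]]]]]]]]]]] h] //; cbn [nth nat_of_ord];
  rewrite mulf_eq0 negb_or => /andP[].
- move=> /comE[rho [rho' [u [v [[n0 n1 n2] [kind O nE _]]]]]].
  rewrite !nE; move: O; case: kind n0 n1 n2 {nE} => [{}rho {}rho'|{}rho {}rho' v'|{}rho {}rho'|{}rho {}rho'|{}rho {}rho'] n0 n1 n2 O;
    rewrite ?root0 ?root0' ?mul0r ?mulr0 ?eqxx // => _.
  exact: orbit_trans (Fc_orbit01 n0 n1 n2) O.
- move=> /comE[rho [rho' [u [v [[n0 n1 n2] [kind O _ sE]]]]]].
  move: O sE; case: kind n0 n1 n2 => [{}rho {}rho'|{}rho {}rho' v'|{}rho {}rho'|{}rho {}rho'|{}rho {}rho'] n0 n1 n2 O sE s0;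
    try by rewrite sE ?eqxx in s0.
  apply: orbit_trans (Fc_orbit03 n0 n1 n2 _) O.
  by apply: contraNneq s0 => v0; rewrite sE // v0 mulr0 oppr0.
- move=> /comE[rho [rho' [u [v [[n0 n1 n2] [kind O nE _]]]]]].
  rewrite !nE; move: O; case: kind n0 n1 n2 {nE} => [{}rho {}rho'|{}rho {}rho' v'|{}rho {}rho'|{}rho {}rho'|{}rho {}rho'] n0 n1 n2 O;
    rewrite ?root0 ?root0' ?mul0r ?mulr0 ?eqxx // => _.
  exact: orbit_trans (Fc_orbit04 n0 n1 n2) O.
- move=> /comE[rho [rho' [u [v [[n0 n1 n2] [kind O nE _]]]]]].
  rewrite !nE; move: O; case: kind n0 n1 n2 {nE} => [{}rho {}rho'|{}rho {}rho' v'|{}rho {}rho'|{}rho {}rho'|{}rho {}rho'] n0 n1 n2 O;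
    rewrite ?root0 ?root0' ?mul0r ?mulr0 ?eqxx // => _.
  exact: orbit_trans (Fc_orbit05 n0 n1 n2) O.
- move=> /comE[rho [rho' [u [v [[n0 n1 n2] [kind O nE _]]]]]].
  move: O; case: kind n0 n1 n2 {nE} => [{}rho {}rho'|{}rho {}rho' v'|{}rho {}rho'|{}rho {}rho'|{}rho {}rho'] n0 n1 n2 O;
    rewrite ?(subrr, mul0r, mulr0) ?eqxx // => _.
  exact: orbit_trans (Fc_orbit07 n0 n1 n2) O.
- move=> /leftE F t; apply: F => n0 /left_cases[cL [cR cS]].
  have z eL eR := @left_orbit b2 d2 eL eR n0.
  case: cS => [[-> ->]|[e1 _ e2 _ _]]; last by move: t; rewrite e1 e2 ?(subrr, mul0r, mulr0) eqxx.
  case: cL => -[e ->]; last by move: t; rewrite e ?(subrr, mul0r, mulr0) eqxx.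
  rewrite {}e in t *.
  case: cR => -[e ->]; last by move: t; rewrite e ?(subrr, mul0r, mulr0) eqxx.
  rewrite {}e.
  by have := z 0 0; rewrite ?(mul0r, mul1r).
- move=> /rightE F t; apply: F => n0 /right_cases[cL [cR cS]].
  have z eL eR := @right_orbit c2 d2 eL eR n0.
  case: cS => [[-> ->]|[e1 _ e2 _ _]]; last by move: t; rewrite e1 e2 ?(subrr, mul0r, mulr0) eqxx.
  case: cL => -[e ->]; last by move: t; rewrite e ?(subrr, mul0r, mulr0) eqxx.
  rewrite {}e in t *.
  case: cR => -[e ->]; last by move: t; rewrite e ?(subrr, mul0r, mulr0) eqxx.
  rewrite {}e.
  by have := z 0 0; rewrite ?(mul0r, mul1r).
- move=> /rightE F t; apply: F => n0 /right_cases[cL [cR cS]].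
  have z eL eR := @right_orbit c2 d2 eL eR n0.
  case: cS => [[_ s0]|[-> -> -> -> E]]; [by rewrite s0 eqxx in t|exact: right_orbit_s].
- move=> /leftE F t; apply: F => n0 /left_cases[cL [cR cS]].
  have z eL eR := @left_orbit b2 d2 eL eR n0.
  case: cS => [[_ s0]|[-> -> -> -> E]]; [by rewrite s0 eqxx in t|exact: left_orbit_s].
- move=> /rightE F t; apply: F => n0 /right_cases[cL [cR cS]].
  have z eL eR := @right_orbit c2 d2 eL eR n0.
  case: cS => [[-> ->]|[e1 _ e2 _ _]]; last by move: t; rewrite e1 e2 ?(subrr, mul0r, mulr0) eqxx.
  case: cL => -[e ->]; last by move: t; rewrite e ?(subrr, mul0r, mulr0) eqxx.
  rewrite {}e in t *.
  case: cR => -[e ->]; first by move: t; rewrite e ?(subrr, mul0r, mulr0) eqxx.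
  rewrite {}e.
  by have := z 0 1; rewrite ?(mul0r, mul1r).
- move=> /leftE F t; apply: F => n0 /left_cases[cL [cR cS]].
  have z eL eR := @left_orbit b2 d2 eL eR n0.
  case: cS => [[-> ->]|[e1 _ e2 _ _]]; last by move: t; rewrite e1 e2 ?(subrr, mul0r, mulr0) eqxx.
  case: cL => -[e ->]; first by move: t; rewrite e ?(subrr, mul0r, mulr0) eqxx.
  rewrite {}e in t *.
  case: cR => -[e ->]; last by move: t; rewrite e ?(subrr, mul0r, mulr0) eqxx.
  rewrite {}e.
  by have := z 1 0; rewrite ?(mul0r, mul1r).
- move=> /rightE F t; apply: F => n0 /right_cases[cL [cR cS]].
  have z eL eR := @right_orbit c2 d2 eL eR n0.
  case: cS => [[-> ->]|[e1 _ e2 _ _]]; last by move: t; rewrite e1 e2 ?(subrr, mul0r, mulr0) eqxx.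
  case: cL => -[e ->]; first by move: t; rewrite e ?(subrr, mul0r, mulr0) eqxx.
  rewrite {}e in t *.
  case: cR => -[e ->]; first by move: t; rewrite e ?(subrr, mul0r, mulr0) eqxx.
  rewrite {}e.
  by have := z 1 1; rewrite ?(mul0r, mul1r).
- move=> /leftE F t; apply: F => n0 /left_cases[cL [cR cS]].
  have z eL eR := @left_orbit b2 d2 eL eR n0.
  case: cS => [[-> ->]|[e1 _ e2 _ _]]; last by move: t; rewrite e1 e2 ?(subrr, mul0r, mulr0) eqxx.
  case: cL => -[e ->]; first by move: t; rewrite e ?(subrr, mul0r, mulr0) eqxx.
  rewrite {}e in t *.
  case: cR => -[e ->]; first by move: t; rewrite e ?(subrr, mul0r, mulr0) eqxx.
  rewrite {}e.
  by have := z 1 1; rewrite ?(mul0r, mul1r).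
Qed.

(** * Invariants separating the thirteen orbits *)

(** The last invariant, [x, y] z = 0 on the even part, tells the product lambda(x) y from lambda(y)
    x when lambda is nonzero. *)
Definition invariant (i : nat) (mu : Str) : Prop :=
  match i with
  | 0 => forall x y, is_homog false x -> is_homog true y -> mult mu x y = fun=> 0
  | 1 => forall x y, is_homog false x -> is_homog true y -> mult mu y x = fun=> 0
  | 2 => forall x y, is_homog true x -> is_homog true y -> mult mu x y = fun=> 0
  | 3 => forall x y, is_homog false x -> is_homog false y -> mult mu x y = mult mu y x
  | _ => forall x y z, is_homog false x -> is_homog false y -> is_homog false z ->
         mult mu (mult mu x y) z = mult mu (mult mu y x) z
  end.

Lemma invariant_orbit i mu nu : str_orbit mu nu -> invariant i mu -> invariant i nu.
Proof.
move=> [g [Gg Hg]]; have [gu _] := Gg; have GV := in_GV Gg.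
have g0 : mxapp g (fun=> 0) = fun=> 0.
  by apply: functional_extensionality => k; rewrite /mxapp big1 // => j _; rewrite mulr0.
have h := fun d x => @mxapp_homog (invmx g) d x GV.
have gg x : mxapp (invmx g) (mxapp g x) = x by rewrite -mxapp_mul mulVmx // mxapp1.
case: i => [|[|[|[|i]]]] H x y => [Hx Hy|Hx Hy|Hx Hy|Hx Hy|z Hx Hy Hz]; rewrite !Hg ?gg.
- by rewrite H ?g0 //; exact: h.
- by rewrite H ?g0 //; exact: h.
- by rewrite H ?g0 //; exact: h.
- by rewrite H //; exact: h.
- by rewrite H //; exact: h.
Qed.

Definition invariant14 (i : nat) (a1 a2 b1 b2 c1 c2 d1 d2 l1 l2 r1 r2 s1 s2 : C) : bool :=
  match i with
  | 0 => (l1 == 0) && (l2 == 0)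
  | 1 => (r1 == 0) && (r2 == 0)
  | 2 => (s1 == 0) && (s2 == 0)
  | 3 => (b1 == c1) && (b2 == c2)
  | _ => [&& (b1 - c1) * a1 + (b2 - c2) * c1 == 0, (b1 - c1) * a2 + (b2 - c2) * c2 == 0,
             (b1 - c1) * b1 + (b2 - c2) * d1 == 0 & (b1 - c1) * b2 + (b2 - c2) * d2 == 0]
  end.

Lemma invariantP i a1 a2 b1 b2 c1 c2 d1 d2 l1 l2 r1 r2 s1 s2 :
  reflect (invariant i (S14 a1 a2 b1 b2 c1 c2 d1 d2 l1 l2 r1 r2 s1 s2))
          (invariant14 i a1 a2 b1 b2 c1 c2 d1 d2 l1 l2 r1 r2 s1 s2).
Proof.
set mu := S14 _ _ _ _ _ _ _ _ _ _ _ _ _ _.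
have even x : is_homog false x -> x o2 = 0 by exact.
have odd x : is_homog true x -> (x o0 = 0) * (x o1 = 0) by move=> h; rewrite !h.
have b0 : is_homog false (bv o0) := @bv_homog o0.
have b1' : is_homog false (bv o1) := @bv_homog o1.
have b2' : is_homog true (bv o2) := @bv_homog o2.
case: i => [|[|[|[|i]]]] /=; apply: (iffP idP).
- move=> /andP[/eqP l10 /eqP l20] x y /even hx /odd hy.
  apply: functional_extensionality; apply: ord3P;
    rewrite /mult !sum3 !sc_mkStr /= ?hx ?hy ?l10 ?l20; ring.
- move=> H; have := congr1 (@^~ o2) (H _ _ b0 b2'); have := congr1 (@^~ o2) (H _ _ b1' b2').
  by rewrite -!sc_mult !sc_mkStr /= => -> ->; rewrite eqxx.
- move=> /andP[/eqP l10 /eqP l20] x y /even hx /odd hy.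
  apply: functional_extensionality; apply: ord3P;
    rewrite /mult !sum3 !sc_mkStr /= ?hx ?hy ?l10 ?l20; ring.
- move=> H; have := congr1 (@^~ o2) (H _ _ b0 b2'); have := congr1 (@^~ o2) (H _ _ b1' b2').
  by rewrite -!sc_mult !sc_mkStr /= => -> ->; rewrite eqxx.
- move=> /andP[/eqP l10 /eqP l20] x y /odd hx /odd hy.
  apply: functional_extensionality; apply: ord3P;
    rewrite /mult !sum3 !sc_mkStr /= ?hx ?hy ?l10 ?l20; ring.
- move=> H; have := congr1 (@^~ o0) (H _ _ b2' b2'); have := congr1 (@^~ o1) (H _ _ b2' b2').
  by rewrite -!sc_mult !sc_mkStr /= => -> ->; rewrite eqxx.
- move=> /andP[/eqP l10 /eqP l20] x y /even hx /even hy.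
  apply: functional_extensionality; apply: ord3P;
    rewrite /mult !sum3 !sc_mkStr /= ?hx ?hy ?l10 ?l20; ring.
- move=> H; have := congr1 (@^~ o0) (H _ _ b0 b1'); have := congr1 (@^~ o1) (H _ _ b0 b1').
  by rewrite -!sc_mult !sc_mkStr /= => -> ->; rewrite !eqxx.
- move=> /and4P[/eqP e1 /eqP e2 /eqP e3 /eqP e4] x y z hx hy hz.
  have M u v : is_homog false u -> is_homog false v -> mult mu u v =
      fun k : 'I_3 => nth 0 [:: mul1 a1 b1 c1 d1 (u o0) (u o1) (v o0) (v o1);
                                mul2 a2 b2 c2 d2 (u o0) (u o1) (v o0) (v o1); 0] k.
    move=> /even hu /even hv; apply: functional_extensionality; apply: ord3P;
      rewrite /mult !sum3 !sc_mkStr /= hu hv /mul1 /mul2; ring.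
  have ev (u v : C) : is_homog false (fun k : 'I_3 => nth 0 [:: u; v; 0] k).
    by move=> j; move: j; apply: ord3P.
  rewrite (M x y) // (M y x) // !M //=.
  apply: functional_extensionality; apply: ord3P => //=; rewrite /mul1 /mul2; apply: subr0_eq.
  (* The commutator [x, y] is the determinant of the coordinates of x, y times [e1, e2]. *)
  + transitivity ((x o0 * y o1 - x o1 * y o0) * (((b1 - c1) * a1 + (b2 - c2) * c1) * z o0 +
      ((b1 - c1) * b1 + (b2 - c2) * d1) * z o1)); [ring|by rewrite e1 e3; ring].
  + transitivity ((x o0 * y o1 - x o1 * y o0) * (((b1 - c1) * a2 + (b2 - c2) * c2) * z o0 +
      ((b1 - c1) * b2 + (b2 - c2) * d2) * z o1)); [ring|by rewrite e2 e4; ring].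
- move=> H.
  have E z k : is_homog false z ->
      mult mu (mult mu (bv o0) (bv o1)) z k - mult mu (mult mu (bv o1) (bv o0)) z k = 0.
    by move=> hz; rewrite H // subrr.
  have D z k : mult mu (mult mu (bv o0) (bv o1)) z k - mult mu (mult mu (bv o1) (bv o0)) z k =
      (b1 - c1) * mult mu (bv o0) z k + (b2 - c2) * mult mu (bv o1) z k.
    have -> : mult mu (bv o0) (bv o1) = nth 0 [:: b1; b2; 0].
      by apply: functional_extensionality => j; rewrite -sc_mult sc_mkStr.
    have -> : mult mu (bv o1) (bv o0) = nth 0 [:: c1; c2; 0].
      by apply: functional_extensionality => j; rewrite -sc_mult sc_mkStr.
    by rewrite /mult !sum3 /bv /=; ring.
  have := (E _ o0 b0, E _ o1 b0, E _ o0 b1', E _ o1 b1').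
  rewrite !D -!sc_mult !sc_mkStr /= => -[[[e1 e2] e3] e4].
  by rewrite e1 e2 e3 e4 eqxx.
Qed.

Lemma Ralg_orbit_inj (k l : 'I_13) : str_orbit (Ralg k) (Ralg l) -> k = l.
Proof.
move=> O.
have inv i : invariant i (Ralg k) <-> invariant i (Ralg l).
  by split; apply: invariant_orbit => //; apply: orbit_sym.
(* Row j holds the truth values of invariants 0 to 4 at [Ralg j]; the rows are pairwise distinct. *)
pose codes := [:: [:: true; true; true; true; true]; [:: false; false; false; true; true];
  [:: true; false; true; true; true]; [:: false; true; true; true; true];
  [:: false; false; true; true; true]; [:: true; true; true; false; true];
  [:: true; true; true; false; false]; [:: false; true; false; false; false];
  [:: true; false; false; false; true]; [:: true; false; true; false; false];
  [:: false; true; true; false; true]; [:: false; false; true; false; false];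
  [:: false; false; true; false; true]].
have code (j : 'I_13) i : (i < 5)%N ->
    reflect (invariant i (Ralg j)) (nth true (nth [::] codes j) i).
  have n1 : (1 == 0 :> C) = false := oner_eq0 _.
  have n2 : (0 == 1 :> C) = false by rewrite eq_sym n1.
  have n3 : (- 1 == 0 :> C) = false by rewrite oppr_eq0.
  have rf (P : Prop) b c : reflect P b -> b = c -> reflect P c by move=> h <-.
  rewrite RalgE /codes; case: j => [[|[|[|[|[|[|[|[|[|[|[|[|[|]]]]]]]]]]]]] h] // i5;
    rewrite [Rtable _]/=; apply: (rf _ _ _ (invariantP _ _ _ _ _ _ _ _ _ _ _ _ _ _ _));
    case: i i5 => [|[|[|[|[|i]]]]] // _; rewrite /=;
    by rewrite ?(subr0, sub0r, mul0r, mulr0, mul1r, mulr1, addr0, add0r, subrr, eqxx, n1, n2, n3).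
have E : nth [::] codes k = nth [::] codes l.
  have sz (j : 'I_13) : size (nth [::] codes j) = 5.
    by case: j => [[|[|[|[|[|[|[|[|[|[|[|[|[|]]]]]]]]]]]]] h].
  apply: (@eq_from_nth _ true) => [|i]; rewrite ?sz // => i5.
  by apply/(code _ _ i5)/(code _ _ i5) => /inv.
apply/val_inj/eqP; rewrite -(nth_uniq [::] _ _ (_ : uniq codes)) ?ltn_ord //.
exact/eqP.
Qed.

(** The test is known to be nonzero only at [Ralg k]; composing it with the action of a g that moves
    mu there gives a polynomial nonzero at mu and zero on the rest of the variety. Hence the orbit
    is open at each of its points. *)
Lemma Ralg_not_zclosure (k : 'I_13) mu : str_orbit (Ralg k) mu ->
  ~ zclosure (fun nu => BAvar nu /\ ~ str_orbit (Ralg k) nu) mu.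
Proof.
move=> /orbit_sym /orbit_act[g Gg kE] Hmu.
have pf : polyfun (fun nu => open_test k (act g nu)).
  by apply: (polyfun_comp (polyfun_open_test k)) => t; apply: polyfun_act.
have := open_test_Ralg k; rewrite kE => /eqP; apply.
apply: (zclosed_polyfun pf) Hmu => nu [X nO].
apply/eqP; apply: contraT => n0; case: nO.
apply: orbit_trans (orbit_sym (act_orbit nu Gg)).
by apply: open_test_orbit n0; apply: BAvar_orbit X _; apply: act_orbit.
Qed.

(** * Irreducible components and rigid algebras *)

Lemma BAvar_Ralg_orbit k mu : str_orbit (Ralg k) mu -> BAvar mu.
Proof. by apply: BAvar_orbit; apply: BAvar_Ralg. Qed.

(** If k <> l, orbit k lies in the complement of the open orbit l, and so does its closure within
    the variety. *)
Lemma Ralg_orbit_zclosure (k l : 'I_13) :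
  subs (str_orbit (Ralg l)) (zclosure (str_orbit (Ralg k))) -> k = l.
Proof.
move=> H; have [//|/eqP kl] := eqVneq k l.
have [] := @Ralg_not_zclosure l (Ralg l) (orbit_refl _).
apply: (zclosure_mono _ (H _ (orbit_refl _))) => nu Ok.
split; first exact: BAvar_Ralg_orbit Ok.
by move=> Ol; apply/kl/Ralg_orbit_inj/(orbit_trans Ok)/orbit_sym.
Qed.

Lemma zclosed_BAvar : zclosed BAvar.
Proof.
move=> mu H; split.
  move=> i j k d; apply: (zclosed_polyfun (polyfun_sc i j k)) H => nu [ev _].
  exact: ev.
have pa x y z k : polyfun (fun nu => assocr nu x y z k).
  have pm u v : (forall i, polyfun (fun nu : Str => u nu i)) ->
      (forall i, polyfun (fun nu : Str => v nu i)) ->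
      forall i, polyfun (fun nu => mult nu (u nu) (v nu) i).
    by move=> hu hv i; apply: polyfun_mult => // *; apply: polyfun_sc.
  by apply: polyfunD; [|apply: polyfunN]; apply: (pm _ _) => i; try exact: polyfun_const;
    apply: (pm _ _) => j; exact: polyfun_const.
have E c x y z x' y' z' k : (forall nu, BAvar nu -> assocr nu x y z k = c * assocr nu x' y' z' k) ->
    assocr mu x y z k = c * assocr mu x' y' z' k.
  move=> Hn; apply: subr0_eq.
  apply: (@zclosed_polyfun BAvar mu (fun nu => assocr nu x y z k - c * assocr nu x' y' z' k)) => //.
    by apply: polyfunD => //; apply/polyfunN/polyfunM => //; exact: polyfun_const.
  by move=> nu /Hn ->; rewrite subrr.
move=> dx dy dz x y z hx hy hz; split=> k; apply: E => nu [_ ba];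
  by have [] := ba _ _ _ _ _ _ hx hy hz.
Qed.

Lemma zclosure_Ralg_sub k : subs (zclosure (str_orbit (Ralg k))) BAvar.
Proof. by apply: zclosure_min zclosed_BAvar _ => mu; apply: BAvar_Ralg_orbit. Qed.

(** An irreducible set containing closure k lies in a single closure l by the covering, and then k =
    l. *)
Lemma component_Ralg k : irr_component BAvar (zclosure (str_orbit (Ralg k))).
Proof.
split; first exact: zclosure_Ralg_sub; split; first exact: irreducible_orbit.
move=> Y kY YX irrY.
have [l Yl] : exists l : 'I_13, subs Y (zclosure (str_orbit (Ralg l))).
  apply: irreducible_union => // [l|y /YX]; first exact: zclosed_zclosure.
  exact: BAvar_cover.
suff -> : k = l by [].
by apply/esym/Ralg_orbit_zclosure => mu /(@zclosure_sub _ mu) /kY /Yl.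
Qed.

Lemma component_eq Y : irr_component BAvar Y ->
  exists k : 'I_13, same_set Y (zclosure (str_orbit (Ralg k))).
Proof.
move=> [YX [irrY maxY]].
have [k Yk] : exists k : 'I_13, subs Y (zclosure (str_orbit (Ralg k))).
  apply: irreducible_union => // [l|y /YX]; first exact: zclosed_zclosure.
  exact: BAvar_cover.
exists k => mu; split; first exact: Yk.
by apply: maxY => //; [exact: zclosure_Ralg_sub|exact: irreducible_orbit].
Qed.

Lemma irreducible_same Y Z : same_set Y Z -> irreducible Z -> irreducible Y.
Proof.
move=> E [[x Zx] H]; split; first by exists x; apply/E.
move=> Z1 Z2 c1 c2 YZ; have [|s|s] := H _ _ c1 c2 => [y /E /YZ //| |].
- by left=> y /E /s.
- by right=> y /E /s.
Qed.

Lemma component_same Y Z : same_set Y Z -> irr_component BAvar Z -> irr_component BAvar Y.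
Proof.
move=> E [ZX [irrZ maxZ]]; split; first by move=> y /E /ZX.
split; first exact: irreducible_same irrZ.
move=> Y' YY' Y'X irrY' y /(maxZ _ _ Y'X irrY') Zy; apply/E; apply: Zy.
by move=> z /E /YY'.
Qed.

Lemma has_chain_mono (X Y : pset Str) n : subs X Y -> has_chain X n -> has_chain Y n.
Proof.
move=> XY [Z [HZ HS]]; exists Z; split=> // i /HZ[c [ir s]]; split=> //; split=> // x /s.
exact: XY.
Qed.

Lemma rigid_Ralg mu : rigid BAvar mu <-> exists k : 'I_13, str_orbit (Ralg k) mu.
Proof.
split=> [[X [Z [cZ E]]]|[k Ok]].
  have [k Hk] := BAvar_cover X; exists k.
  have nZ : ~ Z mu by have /E[] := orbit_refl mu.
  have [p [pZ pmu]] := not_zclosure (fun h => nZ (cZ _ h)).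
  (* The orbit of mu is open and mu lies in closure k, so that orbit meets orbit k and coincides
     with it. *)
  have [nu Onu nuZ] : exists2 nu, str_orbit (Ralg k) nu & ~ Z nu.
    apply: NNPP => nex; case/eqP: pmu; apply: Hk => nu Onu; apply: pZ.
    by apply: NNPP => nZnu; apply: nex; exists nu.
  have Omu : str_orbit mu nu by apply/E; split=> //; apply: BAvar_Ralg_orbit Onu.
  exact: orbit_trans Onu (orbit_sym Omu).
split; first exact: BAvar_Ralg_orbit Ok.
exists (zclosure (fun nu => BAvar nu /\ ~ str_orbit (Ralg k) nu)); split.
  exact: zclosed_zclosure.
move=> nu; split=> [Onu|[X nZ]].
  have Onu' := orbit_trans Ok Onu; split; first exact: BAvar_Ralg_orbit Onu'.
  exact: Ralg_not_zclosure.
apply: orbit_trans (orbit_sym Ok) _; apply: NNPP => nO; apply: nZ.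
exact: zclosure_sub.
Qed.

(** * A chain of length 5 *)

(* R03 in the basis alpha E1, beta E2 + u alpha E1, with f1 rescaled so that f1 f1 = v alpha E1. *)
Definition chain_str (x : 'I_4 -> C) : Str :=
  let: (al, be, v, u) := (x (inord 0), x (inord 1), x (inord 2), x (inord 3)) in
  S14 al 0 (u * al) 0 (u * al) 0 (u ^+ 2 * al - u * be) be al (u * al) al (u * al) v 0.

(** Only the first i parameters stay free, so the images start at the zero algebra and grow by one
    parameter at a time. *)
Definition truncate (i : nat) (x : 'I_4 -> C) : 'I_4 -> C :=
  fun j => if (j < i)%N then x j else 0.

Definition chain_set (i : nat) : pset Str := fun mu => exists x, mu = chain_str (truncate i x).

Lemma polyfun_chain_str t : polyfun (fun x => chain_str x t).
Proof. by apply: polyfun_S14; polyfun_tac. Qed.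

Lemma polyfun_truncate i j : polyfun (fun x => truncate i x j).
Proof.
by rewrite /truncate; case: (j < i)%N; [exact: polyfun_var|exact: polyfun_const].
Qed.

Lemma chain_str_zclosure x : zclosure (str_orbit (Rtable 1)) (chain_str x).
Proof.
pose D (y : 'I_4 -> C) := y (inord 0) * y (inord 1) * y (inord 2).
have pD : polyfun D by rewrite /D; polyfun_tac.
apply: (zclosure_line polyfun_chain_str pD); last first.
  by exists (fun=> 1); rewrite /D !mulr1 oner_neq0.
move=> y; rewrite /D /chain_str; move: (y (inord 0)) (y (inord 1)) (y (inord 2)) (y (inord 3)) => al be v u.
rewrite !mulf_eq0 !negb_or => /andP[/andP[a0 b0] v0].
pose h : C := sqrtC (al * v)^-1.
have hE : h ^+ 2 = (al * v)^-1 by rewrite sqrtCK.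
have h0 : h != 0 by rewrite sqrtC_eq0 invr_eq0 mulf_neq0.
apply: (@S14_orbit al^-1 0 (- u / be) be^-1 h) => //; rewrite ?hE;
  try by field; rewrite ?a0 ?b0 ?v0.
by rewrite mul0r subr0 mulf_neq0 ?invr_eq0.
Qed.

Lemma irreducible_chain_set i : irreducible (zclosure (chain_set i)).
Proof.
apply: (@irreducible_param _ (fun x => chain_str (truncate i x)) (fun=> 1)).
- move=> t; apply: (@polyfun_comp _ _ (fun y => chain_str y t)); first exact: polyfun_chain_str.
  exact: polyfun_truncate.
- exact: polyfun_const.
- by move=> x _; exists x.
- by exists (fun=> 0); exact: oner_neq0.
- by move=> _ [x ->]; exists x => //; exact: oner_neq0.
Qed.

Lemma chain_set_mono i : subs (chain_set i) (chain_set i.+1).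
Proof.
move=> _ [x ->]; exists (truncate i x); congr chain_str.
apply: functional_extensionality => j; rewrite /truncate ltnS.
by case: ltnP => ji; rewrite ?(ltnW ji) ?if_same.
Qed.

Lemma not_sub_zclosure (A B : pset Str) f mu : polyfun f ->
  (forall nu, A nu -> f nu = 0) -> B mu -> f mu != 0 -> ~ subs B (zclosure A).
Proof.
by move=> pf fA Bmu /eqP fmu H; apply: fmu; apply: (zclosed_polyfun pf fA); apply: H.
Qed.

Lemma chain_set_strict i : (i < 4)%N ->
  ~ subs (zclosure (chain_set i.+1)) (zclosure (chain_set i)).
Proof.
have one x : chain_set i.+1 (chain_str (truncate i.+1 x)) by exists x.
pose f (j k l : 'I_3) := fun nu => sc nu j k l.
have S j k l : (forall x, f j k l (chain_str (truncate i x)) = 0) ->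
    f j k l (chain_str (truncate i.+1 (fun=> 1))) != 0 ->
    ~ subs (zclosure (chain_set i.+1)) (zclosure (chain_set i)).
  move=> H0 H1; apply: (not_sub_zclosure (polyfun_sc j k l) _ _ H1).
    by move=> _ [x ->]; apply: H0.
  exact/zclosure_sub/one.
case: i S {one} => [|[|[|[|i]]]] // S _.
(* The separating coordinates are al, be, v and u * al, each containing the newly freed parameter as
   a factor. *)
- by apply: (S o0 o0 o0) => [x|]; rewrite /f sc_mkStr /truncate /= ?inordK //= oner_neq0.
- by apply: (S o1 o1 o1) => [x|]; rewrite /f sc_mkStr /truncate /= ?inordK //= oner_neq0.
- by apply: (S o2 o2 o0) => [x|]; rewrite /f sc_mkStr /truncate /= ?inordK //= oner_neq0.
- apply: (S o0 o1 o0) => [x|]; rewrite /f sc_mkStr /truncate /= ?inordK //= ?mul0r //.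
  by rewrite mulr1 oner_neq0.
Qed.

Lemma has_chain5 : has_chain (zclosure (str_orbit (Rtable 1))) 5.
Proof.
have sub i : subs (zclosure (chain_set i)) (zclosure (str_orbit (Rtable 1))).
  apply: zclosure_min; first exact: zclosed_zclosure.
  by move=> _ [x ->]; apply: chain_str_zclosure.
exists (fun i => if (i < 5)%N then zclosure (chain_set i) else zclosure (str_orbit (Rtable 1))).
split=> i; case: ltnP => i5.
- move=> _; split; first exact: zclosed_zclosure; split; first exact: irreducible_chain_set.
  exact: sub.
- move=> _; split; first exact: zclosed_zclosure; split; first exact: irreducible_orbit.
  by [].
- move=> _; have [i4|i4] := ltnP i 4.
    rewrite ltnS i4; split; last exact: chain_set_strict.
    exact/zclosure_mono/chain_set_mono.
  rewrite ltnS leqNgt ltnS i4 /=; split; first exact: sub.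
  (* All chain structures have f1 f1 proportional to e1; exchanging e1 and e2 in R03 gives a point
     of the orbit with f1 f1 = e2. *)
  apply: (@not_sub_zclosure _ _ (fun nu => sc nu o2 o2 o1) (S14 1 0 0 0 0 0 0 1 0 1 0 1 0 1)).
  + exact: polyfun_sc.
  + by move=> _ [x ->]; rewrite sc_mkStr.
  + apply: zclosure_sub; apply: (@S14_orbit 0 1 1 0 1); rewrite ?oner_neq0 //; try ring.
    by rewrite mulr0 mul1r sub0r oppr_eq0 oner_neq0.
  + by rewrite sc_mkStr /= oner_neq0.
- by [].
Qed.

Theorem mainTheorem12 :
  variety_dim_eq BAvar 5 /\
  (forall Y, irr_component BAvar Y <->
     exists k : 'I_13, same_set Y (zclosure (str_orbit (Ralg k)))) /\
  (forall k l : 'I_13,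
     same_set (zclosure (str_orbit (Ralg k))) (zclosure (str_orbit (Ralg l))) -> k = l) /\
  (forall mu, rigid BAvar mu <-> exists k : 'I_13, str_orbit (Ralg k) mu).
Proof.
have dim Y : irr_component BAvar Y -> ~ has_chain Y 6.
  move=> /component_eq[k E] ch; apply: (@orbit_no_chain (Ralg k)).
  by apply: has_chain_mono ch => mu /E.
split; last split; last split.
(* Index 1 is R03, whose orbit closure carries the chain of length 5. *)
- split=> //; pose k : 'I_13 := inord 1.
  have comp := component_Ralg k.
  exists (zclosure (str_orbit (Ralg k))); split=> //; split; last exact: dim.
  by rewrite RalgE inordK //; apply: has_chain5.
- move=> Y; split; first exact: component_eq.
  by move=> [k E]; apply: component_same E (component_Ralg k).
- by move=> k l E; apply: Ralg_orbit_zclosure => mu /(@zclosure_sub _ mu) /E.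
- exact: rigid_Ralg.
Qed.
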